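(* Let $X$ be a Banach space. Assume that there exists a normalized weakly null basic sequence $(x_i)$ in $X$ having a spreading model $(\tilde x_i)$ which is not equivalent to the unit vector basis of $\ell_1$, yet $1$ belongs to the Krivine set of $(\tilde x_i)$. Then there exist a (closed) subspace $W$ of $X$ and a continuous linear operator $T:W\to W$ such that, for every non-constant polynomial $p$, $p(T)$ is not a compact perturbation of a multiple of the identity operator on $W$ (that is, $p(T)-\lambda I$ is not compact for any scalar $\lambda$).
   Context: Banach spaces are real. A seminormalized sequence $(x_i)$ in a Banach space has (generates) the spreading model $(\tilde x_i)$, where $(\tilde x_i)$ is a basic sequence in some Banach space, if for some sequence $\varepsilon_n\searrow 0$ one has, for all $n\in\mathbb{N}$, all $(a_i)_{i=1}^n\in[-1,1]^n$ and all integers $n\le k_1<\dots<k_n$, $$\left|\Big\|\sum_{i=1}^n a_i x_{k_i}\Big\|-\Big\|\sum_{i=1}^n a_i\tilde x_i\Big\|\right|<\varepsilon_n .$$ The Krivine set of a 1-subsymmetric basic sequence $(x_i)$ (as every spreading model of a weakly null sequence is) is the set of all $p\in[1,\infty]$ such that for all $\varepsilon>0$ and $n\in\mathbb{N}$ there exist $m\in\mathbb{N}$ and $(\lambda_k)_{k=1}^m\subset\mathbb{R}$ such that for all $(a_i)_{i=1}^n\subset\mathbb{R}$ $$\frac1{1+\varepsilon}\|(a_i)_{i=1}^n\|_p\le\Big\|\sum_{i=1}^na_iy_i\Big\|\le(1+\varepsilon)\|(a_i)_{i=1}^n\|_p,\qquad y_i=\sum_{k=1}^m\lambda_kx_{(i-1)m+k}\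 (i=1,\dots,n),$$ where $\|\cdot\|_p$ is the $\ell_p$ norm. *)

(* Defs.v *)
(* MathComp-Analysis: real Banach spaces are [completeNormedModType R] over
   [R : realType].  Sequences are indexed from 0, so the [k]-th term of the
   1-indexed literature is [x k.-1]. *)
From HB Require Import structures.
From mathcomp Require Import all_boot all_order all_algebra.
From mathcomp Require Import all_classical all_reals all_analysis.
Set Implicit Arguments.
Unset Strict Implicit.
Unset Printing Implicit Defensive.
Import Order.TTheory GRing.Theory Num.Theory.
Import numFieldNormedType.Exports.
Local Open Scope classical_set_scope.
Local Open Scope ring_scope.

Section sequences_in_Banach_spaces.
Context {R : realType}.

(* Meaningful for [1 <= p]; the value at [-oo] is junk. *)
Definition lp_norm (p : \bar R) (n : nat) (a : 'I_n -> R) : R :=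
  match p with
  | q%:E => (\sum_(i < n) `|a i| `^ q) `^ q^-1
  | +oo%E => \big[Num.max/0]_(i < n) `|a i|
  | -oo%E => 0
  end.

Definition normalized (X : normedModType R) (x : nat -> X) : Prop :=
  forall i, `|x i| = 1.

Definition seminormalized (X : normedModType R) (x : nat -> X) : Prop :=
  exists c C : R, 0 < c /\ forall i, c <= `|x i| <= C.

Definition weakly_null (X : normedModType R) (x : nat -> X) : Prop :=
  forall f : {linear X -> R^o}, continuous f -> f (x i) @[i --> \oo] --> 0.

Definition lin_span (X : lmodType R) (x : nat -> X) : set X :=
  [set y | exists (n : nat) (a : 'I_n -> R), y = \sum_(i < n) a i *: x i].

(* [x] is a Schauder basis of its closed linear span. *)
Definition basic_seq (X : normedModType R) (x : nat -> X) : Prop :=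
  forall y, closure (lin_span x) y ->
    exists! a : nat -> R, series (fun i => a i *: x i) @ \oo --> y.

(* Equivalence with the unit vector basis (e_i) of l_1, in which
   |\sum_i a_i e_i| is the l_1 norm of a. *)
Definition equiv_l1_basis (X : normedModType R) (x : nat -> X) : Prop :=
  exists c C : R, [/\ 0 < c, 0 < C &
    forall (n : nat) (a : 'I_n -> R),
      c * lp_norm 1%E a <= `|\sum_(i < n) a i *: x i| <= C * lp_norm 1%E a].

(* [n <= (k i).+1] is the usual n <= k_1 < ... < k_n in 1-based indexing. *)
Definition has_spreading_model (X Y : normedModType R)
    (x : nat -> X) (xt : nat -> Y) : Prop :=
  [/\ seminormalized x, basic_seq xt &
    exists eps : nat -> R, [/\ nonincreasing_seq eps, eps @ \oo --> 0 &
      forall (n : nat) (a : 'I_n -> R) (k : 'I_n -> nat),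
        (forall i, -1 <= a i <= 1) ->
        (forall i, (n <= (k i).+1)%N) ->
        (forall i j : 'I_n, (i < j)%N -> (k i < k j)%N) ->
        `| `|\sum_(i < n) a i *: x (k i)| - `|\sum_(i < n) a i *: xt i| |
          < eps n]].

Definition Krivine_set (X : normedModType R) (x : nat -> X) : set (\bar R) :=
  [set p | (1 <= p)%E /\
    forall (eps : R) (n : nat), 0 < eps ->
      exists (m : nat) (lam : 'I_m -> R),
        let y i := \sum_(k < m) lam k *: x (i * m + k)%N in
        forall a : 'I_n -> R,
          (1 + eps)^-1 * lp_norm p a <= `|\sum_(i < n) a i *: y i|
            <= (1 + eps) * lp_norm p a].

End sequences_in_Banach_spaces.

(* An operator on a subspace [W] of [X] is given by a map [T : X -> X] of which
   only the restriction to [W] matters. *)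
Section operators_on_subspaces.
Context {R : realType} {X : normedModType R}.
Implicit Types (W : set X) (T : X -> X).

Definition closed_subspace W : Prop :=
  [/\ W 0, forall (a : R) u v, W u -> W v -> W (a *: u + v) & closed W].

Definition continuous_operator_on W T : Prop :=
  [/\ forall x, W x -> W (T x),
      forall (a : R) u v, W u -> W v -> T (a *: u + v) = a *: T u + T v &
      {within W, continuous T}].

(* Since [W] is closed, relative compactness in [W] and in [X] agree. *)
Definition compact_operator_on W T : Prop :=
  continuous_operator_on W T /\
  precompact (T @` (W `&` [set x | `|x| <= 1])).

Definition poly_operator (p : {poly R}) T : X -> X :=
  fun x => \sum_(i < size p) p`_i *: iter i T x.

End operators_on_subspaces.

(* Main.v *)
Require Import Defs.
From HB Require Import structures.
From mathcomp Require Import all_boot all_order all_algebra.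
From mathcomp Require Import all_classical all_reals all_analysis.
From mathcomp Require Import ring lra zify.
Import Order.TTheory GRing.Theory Num.Theory.
Import numFieldNormedType.Exports.
Local Open Scope classical_set_scope.
Local Open Scope ring_scope.
Set Implicit Arguments.
Unset Strict Implicit.
Unset Printing Implicit Defensive.

(** The operator is a weighted backward shift along countably many bounded
    sequences: [T (z i.+1 j) = tau i *: z i j] and [T (z 0 j) = 0], on the
    closed linear span of all the vectors [z i j].  Such a shift has no compact
    polynomial.  If [p] has degree [d > 0], then [T ^ d] carries [z d j] to a
    nonzero multiple of [z 0 j]; as the coordinates with respect to [z] are
    uniformly bounded functionals, the vectors [p(T) (z d j) - lambda *: z d j]
    are uniformly separated when [j] varies, whatever [lambda] is.

    So everything rests on finding sequences such that each [z i.+1] dominates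
    [z i], in the presence of all the other vectors of the span.  The two
    hypotheses on the spreading model pull in opposite directions, and both are
    used.

    - The spreading model is not l_1, so sums grow slowly: for every [e] there
      is [N] such that far enough out in the sequence the norm of a sum with
      coefficients [a j] is at most [e * (sum |a j| + N * max |a j|)]
      ([sublinear_sums]).
    - The Krivine set contains 1, so for every [n] some finite block of [x],
      repeated [n] times far enough out, spans l_1^n almost isometrically
      ([krivine_block]).

    The vector [z i j] is the sum over [r <= j] of [2 ^ -r] times such a block
    for some [n = n i r].  A combination of norm 1 then has coefficients whose
    absolute values sum to at most a constant times [2 ^ s] over any [n i s]
    indices beyond [s].  If [n i.+1 s] increases fast enough, at a rate dictated
    by the slow growth of [z i], this forces the combination of [z i] with the
    same coefficients to be bounded ([domination]): few coefficients are of a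
    given order of magnitude, and on them slow growth gains a factor [4 ^ -s].
    Since [z i] consists of finite blocks with summable weights, it inherits
    slow growth from [x] ([weighted_sublinear]), so the choice can be repeated
    for all [i] ([tower_blocks]).

    The remaining difficulty is that [x] may have no unconditional subsequence,
    so that a lower bound for the norm of a few terms says nothing about a
    longer sum containing them.  This is settled by [decoupling], a form of the
    Schreier unconditionality of weakly null sequences: after passing to a
    subsequence, a functional that norms finitely many terms may be replaced,
    at the cost of a factor 2, by one which nearly vanishes on all other terms.
    It is obtained by subtracting from the functional its iterated limit along
    an ultrafilter. *)


(** * Norming functionals *)

Section hahn_banach.
Context {R : realType} {X : normedModType R}.
Implicit Types (p q f : X -> R).

(** Plain functions rather than bundled linear maps: most of these functionals
    arise as pointwise limits or from a choice. *)
Definition contractive f :=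
  (forall (a : R) u v, f (a *: u + v) = a * f u + f v) /\
  forall u, `|f u| <= `|u|.

Definition sublinear p :=
  (forall u v, p (u + v) <= p u + p v) /\
  (forall (t : R) u, 0 < t -> p (t *: u) = t * p u).

Lemma functional0 f :
  (forall (a : R) u v, f (a *: u + v) = a * f u + f v) -> f 0 = 0.
Proof. by move=> flin; have := flin 1 0 0; rewrite scaler0 addr0 mul1r; lra. Qed.

Lemma functional_sum f : (forall (a : R) u v, f (a *: u + v) = a * f u + f v) ->
  forall (I : Type) (r : seq I) (P : pred I) (a : I -> R) (v : I -> X),
  f (\sum_(i <- r | P i) a i *: v i) = \sum_(i <- r | P i) a i * f (v i).
Proof.
move=> flin I r P a v; elim/big_rec2: _ => [|i s w _ IH]; first exact: functional0.
by rewrite flin IH.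
Qed.

Lemma functional_sum1 f : (forall (a : R) u v, f (a *: u + v) = a * f u + f v) ->
  forall (I : Type) (r : seq I) (P : pred I) (v : I -> X),
  f (\sum_(i <- r | P i) v i) = \sum_(i <- r | P i) f (v i).
Proof.
move=> flin I r P v; rewrite -[LHS](congr1 f (eq_bigr _ (fun i _ => scale1r (v i)))).
by rewrite functional_sum//; apply: eq_bigr => i _; rewrite mul1r.
Qed.

Lemma sublinear0 p : sublinear p -> p 0 = 0.
Proof.
move=> [_ /(_ 2%R 0)]; rewrite scaler0 => /(_ (ltr0n _ 2)) h.
lra.
Qed.

Lemma sublinear_opp p u : sublinear p -> - p (- u) <= p u.
Proof.
by move=> sp; rewrite -subr_ge0 opprK -(sublinear0 sp) -[X in p X <= _](subrr u) sp.1.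
Qed.

(** The infimum over [t >= 0] of [p (u + t *: v) - t * p v] is again sublinear;
    [t = 0] and [t = 1] give the two upper bounds.  This one construction serves
    twice: to see that a minimal sublinear functional is additive, and to start
    from a functional that is already extremal in a given direction. *)
Lemma sublinear_decrease p v : sublinear p ->
  exists q, [/\ sublinear q, (forall u, q u <= p u) &
                forall u, q u <= p (u + v) - p v].
Proof.
move=> sp; have [pD pZ] := sp.
pose S u := [set p (u + t *: v) - t * p v | t in [set t | 0 <= t]].
have Slb u : lbound (S u) (- p (- u)).
  move=> _ [t /= t0 <-].
  have -> : t * p v = p (t *: v).
    move: t0; rewrite le0r => /orP[/eqP->|t0]; last by rewrite pZ.
    by rewrite mul0r scale0r sublinear0.
  have := pD (u + t *: v) (- u); rewrite addrAC subrr add0r; lra.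
have Sne u : S u !=set0 by exists (p (u + 0 *: v) - 0 * p v); exists 0 => //=.
have Sle u t : 0 <= t -> inf (S u) <= p (u + t *: v) - t * p v.
  by move=> t0; apply: ge_inf; [exists (- p (- u)) | exists t].
have Sge u (c : R) : (forall t, 0 <= t -> c <= p (u + t *: v) - t * p v) ->
    c <= inf (S u).
  by move=> h; apply: lb_le_inf => // _ [t t0 <-]; apply: h.
have qZ (t : R) u : 0 < t -> inf (S (t *: u)) <= t * inf (S u).
  move=> t0; rewrite mulrC -ler_pdivrMr//; apply: (Sge) => s s0.
  rewrite ler_pdivrMr//; apply: (le_trans (Sle _ (t * s) _)).
    by rewrite mulr_ge0// ltW.
  by rewrite -scalerA -scalerDr pZ// mulrBl [_ * t]mulrC lerD2l lerN2; lra.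
exists (fun u => inf (S u)); split.
- split=> [u v'|t u t0].
  + rewrite -lerBlDr; apply: (Sge) => t t0.
    rewrite lerBlDr -lerBlDl; apply: (Sge) => s s0.
    rewrite lerBlDl (le_trans (Sle _ (t + s) _)) ?addr_ge0//.
    have := pD (u + t *: v) (v' + s *: v); rewrite addrACA -scalerDl.
    by rewrite mulrDl; lra.
  + apply/eqP; rewrite eq_le qZ//=.
    have := qZ t^-1 (t *: u); rewrite invr_gt0 => /(_ t0).
    by rewrite scalerA mulVf ?gt_eqF// scale1r ler_pdivlMl.
- by move=> u; rewrite (le_trans (Sle u 0 _))// scale0r addr0 mul0r subr0.
- by move=> u; rewrite (le_trans (Sle u 1 _))// scale1r mul1r.
Qed.

(** Hahn-Banach by minimality: below [p] there is, by Zorn, a minimal sublinear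
    functional [m]; as [sublinear_decrease] cannot decrease it further, the bound
    [m (u + v) - m v] is at least [m u], so [m] is additive. *)
Lemma linear_below_sublinear p : sublinear p ->
  exists f, (forall (a : R) u v, f (a *: u + v) = a * f u + f v) /\
            forall u, f u <= p u.
Proof.
move=> sp.
pose T := {q : X -> R | sublinear q /\ forall u, q u <= p u}.
have t0 : T by exists p; split.
have [||A Atot|[m [sm mp]] mmin] :=
  @ZL_preorder T t0 (fun q r : T => `[< forall u, sval r u <= sval q u >]).
- by move=> q; apply/asboolP.
- move=> r q s /asboolP qr /asboolP rs; apply/asboolP => u.
  exact: le_trans (rs u) (qr u).
- have [[q0 Aq0]|A0] := pselect (A !=set0); last first.
    by exists t0 => s As; exfalso; apply: A0; exists s.
  pose S u := [set sval q u | q in A].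
  have lbS u : lbound (S u) (- p (- u)).
    move=> _ [[q [sq qp]] _ <-] /=.
    by apply: le_trans (sublinear_opp _ sq); rewrite lerN2.
  have Sne u : S u !=set0 by exists (sval q0 u); exists q0.
  have Sle u (q : T) : A q -> inf (S u) <= sval q u.
    by move=> Aq; apply: ge_inf; [exists (- p (- u)) | exists q].
  have Sge u (c : R) : (forall q : T, A q -> c <= sval q u) -> c <= inf (S u).
    by move=> h; apply: lb_le_inf => // _ [t At <-]; apply: h.
  have sS : sublinear (fun u => inf (S u)).
    have qZ (t : R) u : 0 < t -> inf (S (t *: u)) <= t * inf (S u).
      move=> t_gt0; rewrite mulrC -ler_pdivrMr//; apply: (Sge) => q Aq.
      rewrite ler_pdivrMr// (le_trans (Sle _ q Aq))// mulrC.
      by rewrite (svalP q).1.2.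
    split=> [u v|t u t_gt0].
    + rewrite -lerBlDr; apply: (Sge) => q Aq.
      rewrite lerBlDr -lerBlDl; apply: (Sge) => r Ar; rewrite lerBlDl.
      have [/asboolP qr|/asboolP rq] := Atot q r Aq Ar.
        apply: le_trans (Sle _ r Ar) _; apply: le_trans ((svalP r).1.1 _ _) _.
        by rewrite lerD.
      apply: le_trans (Sle _ q Aq) _; apply: le_trans ((svalP q).1.1 _ _) _.
      by rewrite lerD.
    + apply/eqP; rewrite eq_le qZ//=.
      have := qZ t^-1 (t *: u); rewrite invr_gt0 => /(_ t_gt0).
      by rewrite scalerA mulVf ?gt_eqF// scale1r ler_pdivlMl.
  have Sp u : inf (S u) <= p u by apply: le_trans (Sle u q0 Aq0) ((svalP q0).2 u).
  exists (exist (fun q => sublinear q /\ forall u, q u <= p u) _ (conj sS Sp)).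
  by move=> q Aq; apply/asboolP => u; apply: (Sle).
- have mD u v : m (u + v) = m u + m v.
    apply/eqP; rewrite eq_le sm.1/=.
    have [q [sq qm qv]] := sublinear_decrease v sm.
    have qp w : q w <= p w by apply: le_trans (qm w) (mp w).
    pose q' : T := exist (fun q => sublinear q /\ forall u, q u <= p u) q (conj sq qp).
    have /asboolP/(_ u)/= := mmin q' (introT (asboolP _) qm).
    by have := qv u; lra.
  have mN u : m (- u) = - m u.
    by apply/eqP; rewrite -addr_eq0 -mD addNr sublinear0.
  exists m; split=> // a u v; rewrite mD; congr (_ + _).
  have [a0|a0|->] := ltgtP a 0; last by rewrite scale0r mul0r sublinear0.
    by rewrite -{1}[a]opprK scaleNr mN sm.2 ?oppr_gt0// mulNr opprK.
  by rewrite sm.2.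
Qed.

Lemma norming_functional (v : X) : exists f, contractive f /\ f v = `|v|.
Proof.
have sn : sublinear (fun u : X => `|u|).
  split=> [u w|t u t0]; first exact: ler_normD.
  by rewrite normrZ gtr0_norm.
have [q [sq qn qv]] := sublinear_decrease v sn.
have [f [flin fq]] := linear_below_sublinear sq.
have f0 := functional0 flin.
have fN u : f (- u) = - f u.
  by have := flin (-1) u 0; rewrite addr0 scaleN1r f0 addr0 mulN1r.
have fn u : f u <= `|u| by apply: le_trans (fq u) (qn u).
exists f; split.
  split=> // u; rewrite ler_norml fn andbT -[f u]opprK -fN lerN2.
  by rewrite -(normrN u) fn.
apply/eqP; rewrite eq_le fn/=.
by have := le_trans (fq (- v)) (qv (- v)); rewrite addNr normr0 fN; lra.
Qed.

End hahn_banach.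

(** * Decoupling along a subsequence *)

Section decoupling.
Context {R : realType} {X : normedModType R}.
Implicit Types (f g F : X -> R).

Lemma filter_forall_seq (T : Type) (I : eqType) (U : set_system T) (r : seq I)
    (P : I -> T -> Prop) : Filter U ->
  (forall i, i \in r -> \forall k \near U, P i k) ->
  \forall k \near U, forall i, i \in r -> P i k.
Proof.
move=> FU; elim: r => [|i r IH] h; first by near do by [].
have hi := h i (mem_head _ _).
have hr := IH (fun j jr => h j (mem_behead (s := i :: r) jr)).
by near=> k => j; rewrite inE => /predU1P[->|]; [|move: j]; near: k.
Unshelve. all: by end_near. Qed.

Lemma filter_forall_subseq (T : Type) (I : eqType) (U : set_system T)
    (h : seq I) (P : seq I -> T -> Prop) : Filter U ->
  (forall s, subseq s h -> \forall k \near U, P s k) ->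
  \forall k \near U, forall s, subseq s h -> P s k.
Proof.
move=> FU hP.
have : \forall k \near U, forall b : (size h).-tuple bool, P (mask b h) k.
  by apply: filter_forall => b; apply/hP/mask_subseq.
apply: filterS => k hk s /subseqP[b szb ->].
by move/eqP: szb => szb; exact: (hk (Tuple szb)).
Qed.

Lemma ultrafilter_limit (U : set_system nat) (h : nat -> R) (B : R) :
  UltraFilter U -> (forall k, `|h k| <= B) ->
  exists2 l : R, `|l| <= B & forall e : R, 0 < e -> \forall k \near U, `|h k - l| < e.
Proof.
move=> UU hB; have PU : ProperFilter U := @ultra_proper _ U UU.
have cB := @segment_compact R (- B) B.
have hU : (h @ U) [set` `[(- B), B]].
  apply: (@filterS _ U _ setT); last exact: filterT.
  by move=> k _ /=; rewrite in_itv/= -ler_norml.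
have [l [lB hl]] := cB (h @ U) _ hU.
exists l; first by move: lB; rewrite /= in_itv/= -ler_norml.
move=> e e0; pose A := [set k | `|h k - l| < e].
have [//|UnA] := in_ultra_setVsetC A UU.
have [] := hl (h @` (~` A)) [set z | `|l - z| < e].
- by apply: (@filterS _ U _ (~` A)) => // k Ak; exists k.
- by apply/nbhs_normP; exists e.
- by move=> z [[k Ak <-]] /=; rewrite distrC.
Qed.

Lemma contractive_limit (U : set_system nat) (f : nat -> X -> R) :
  UltraFilter U -> (forall k, contractive (f k)) ->
  exists F, contractive F /\
    forall u (e : R), 0 < e -> \forall k \near U, `|f k u - F u| < e.
Proof.
move=> UU cf; have PU : ProperFilter U := @ultra_proper _ U UU.
have /choice[F hF] u : exists l : R, `|l| <= `|u| /\
    forall e : R, 0 < e -> \forall k \near U, `|f k u - l| < e.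
  have [l lu hl] := @ultrafilter_limit U (fun k => f k u) `|u| UU (fun k => (cf k).2 u).
  by exists l.
exists F; split; last by move=> u; have [] := hF u.
split=> [a u v|u]; last by have [] := hF u.
apply/eqP; rewrite -subr_eq0 -normr_le0; apply/ler_addgt0Pl => e e0.
rewrite addr0.
pose d := e / (2 + `|a|); have d0 : 0 < d by rewrite divr_gt0// ltr_wpDr.
have [_ huv] := hF (a *: u + v); have [_ hu] := hF u; have [_ hv] := hF v.
have [k] : exists k, [/\ `|f k (a *: u + v) - F (a *: u + v)| < d,
   `|f k u - F u| < d & `|f k v - F v| < d].
  apply: (@filter_ex _ U); near=> k; split; near: k.
  - exact: huv.
  - exact: hu.
  - exact: hv.
rewrite (cf k).1 => -[h1 h2 h3].
have -> : F (a *: u + v) - (a * F u + F v) =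
   - (a * f k u + f k v - F (a *: u + v)) + (a * (f k u - F u) + (f k v - F v)).
  by ring.
have e_eq : e = d + (`|a| * d + d).
  by rewrite /d; field; rewrite gt_eqF// ltr_wpDr.
rewrite e_eq; apply: (le_trans (ler_normD _ _)); rewrite normrN; apply: lerD.
  exact: ltW.
apply: (le_trans (ler_normD _ _)); rewrite normrM; apply: lerD; last exact: ltW.
by rewrite ler_wpM2l// ltW.
Unshelve. all: by end_near. Qed.

(** [H s] is the iterated limit of [f (s ++ [:: k1; ...; kr])] over the [r]
    missing entries, the last entry going to infinity first. *)
Lemma iterated_limits (U : set_system nat) (N : nat) (f : seq nat -> X -> R) :
  UltraFilter U -> (forall s, contractive (f s)) ->
  exists H : seq nat -> X -> R,
    [/\ forall s, contractive (H s), forall s, size s = N -> H s = f s &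
        forall s u (e : R), (size s < N)%N -> 0 < e ->
          \forall k \near U, `|H (rcons s k) u - H s u| < e].
Proof.
move=> UU cf.
have /choice[lim hlim] : forall h : {h : nat -> X -> R | forall k, contractive (h k)},
    exists F, contractive F /\
    forall u (e : R), 0 < e -> \forall k \near U, `|sval h k u - F u| < e.
  by move=> [h hh]; apply: contractive_limit.
pose pack (h : nat -> {F : X -> R | contractive F}) :=
  exist (fun h : nat -> X -> R => forall k, contractive (h k))
    (fun k => sval (h k)) (fun k => svalP (h k)).
pose fix G (n : nat) (s : seq nat) {struct n} : {F : X -> R | contractive F} :=
  if n is n'.+1 then
    exist (fun F => contractive F) (lim (pack (fun k => G n' (rcons s k))))
      (hlim (pack (fun k => G n' (rcons s k)))).1
  else exist (fun F => contractive F) (f s) (cf s).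
exists (fun s => sval (G (N - size s)%N s)); split.
- by move=> s; exact: svalP.
- by move=> s sN; rewrite sN subnn.
- move=> s u e sN e0; rewrite -(subnSK sN).
  have := (hlim (pack (fun k => G (N - (size s).+1)%N (rcons s k)))).2 u e e0.
  by apply: filterS => k /=; rewrite size_rcons.
Qed.

Lemma half_expn_le1 (l : nat) : 2^-1 ^+ l <= 1 :> R.
Proof. by apply: exprn_ile1; rewrite ?invr_ge0// invf_le1// ler1n. Qed.

Lemma geometric_tail_le (l J : nat) (d : R) : 0 < d ->
  \sum_(l.+1 <= l' < J) d * 2^-1 ^+ l' <= d * 2^-1 ^+ l.
Proof.
move=> d0; have [lJ|Jl] := ltnP l J; last first.
  by rewrite big_geq ?(leq_trans Jl)// mulr_ge0 ?exprn_ge0// ltW.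
suff -> : \sum_(l.+1 <= l' < J) d * 2^-1 ^+ l' = d * 2^-1 ^+ l - d * 2^-1 ^+ J.-1.
  by rewrite gerBl mulr_ge0 ?exprn_ge0// ltW.
case: J lJ => // J; rewrite ltnS /=; elim: J => [|J IH].
  by rewrite leqn0 => /eqP->; rewrite big_geq// subrr.
rewrite leq_eqVlt => /predU1P[->|lJ]; first by rewrite big_geq// subrr.
by rewrite big_nat_recr//= IH// exprS; field.
Qed.

Lemma sum_half_le2 (n : nat) : \sum_(i < n) 2^-1 ^+ i <= 2 :> R.
Proof.
case: n => [|n]; first by rewrite big_ord0.
rewrite big_ord_recl expr0 -(big_mkord xpredT (fun i => 2^-1 ^+ i.+1)).
have := geometric_tail_le 0 n.+1 ltr01; rewrite big_add1/=.
by under eq_bigr do rewrite mul1r; rewrite expr0; lra.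
Qed.

Lemma history_choice (T : Type) (E : seq T -> T -> Prop) :
  (forall h, exists k, E h k) -> exists m : nat -> T, forall l, E (mkseq m l) (m l).
Proof.
move=> /choice[e he].
pose fix hist l : seq T := if l is l'.+1 then rcons (hist l') (e (hist l')) else [::].
exists (fun l => e (hist l)) => l.
suff -> : mkseq (fun l => e (hist l)) l = hist l by [].
by elim: l => // l IH; rewrite mkseqS IH.
Qed.

(** At stage [l] a vector [y l (m l)] is chosen in a weakly null sequence.  The
    index set [T] names the kinds of functionals to be decoupled: those of kind
    [t] depend on [N t] entries, and only the finitely many kinds in [act l]
    have to be respected at stage [l].  Selecting the stages in [b] yields
    a functional [f t s]; [g] is [f t s] minus its iterated limit [H t [::]].

    With [S l] the entries selected before stage [l], the number [m l] is chosen
    so large that [H t (S l)] nearly vanishes on [y l (m l)], by weak nullness,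
    and so that appending [m l] to [S l] hardly changes the value of [H t (S l)]
    on the earlier vectors, by definition of the limit.  On a vector that is not
    selected, the values of [H t (S l')] for [l' > l] thus stay close to
    [H t (S l)], hence to zero, up to the end where they equal [f t s]. *)
Lemma decoupling (T : eqType) (act : nat -> seq T) (N : T -> nat)
    (f : T -> seq nat -> X -> R) (y : nat -> nat -> X) (L : seq nat -> nat)
    (d : R) :
  0 < d ->
  (forall l l', (l <= l')%N -> {subset act l <= act l'}) ->
  (forall l F, contractive F -> F (y l k) @[k --> \oo] --> 0) ->
  (forall t s, contractive (f t s)) ->
  exists m : nat -> nat, (forall l, (L (mkseq m l) <= m l)%N) /\
    forall (t : T) (b : pred nat) (J : nat),
      let s := [seq m l | l <- iota 0 J & b l] in
      size s = N t -> (forall l, b l -> t \in act l) ->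
      exists g, [/\ forall (a : R) u v, g (a *: u + v) = a * g u + g v,
        forall u, `|g u| <= 2 * `|u|,
        forall l, (l < J)%N -> b l ->
          `|g (y l (m l)) - f t s (y l (m l))| <= 3 * d * 2^-1 ^+ l &
        forall l, (l < J)%N -> ~~ b l -> `|g (y l (m l))| <= 3 * d * 2^-1 ^+ l].
Proof.
move=> d0 actS ynull cf.
pose theta l := d * 2^-1 ^+ l.
have th0 l : 0 < theta l by rewrite mulr_gt0// exprn_gt0// invr_gt0.
have thE l : 3 * d * 2^-1 ^+ l = 2 * theta l + theta l by rewrite /theta; ring.
have [U [UU ooU]] := ultraFilterLemma (@eventually_filter).
have PU : ProperFilter U := @ultra_proper _ U UU.
have /choice[H hH] := fun t => @iterated_limits U (N t) (f t) UU (cf t).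
pose E h k := (L h <= k)%N /\ forall t, t \in act (size h) ->
      forall s, subseq s h -> `|H t s (y (size h) k)| < theta (size h) /\
       ((size s < N t)%N -> forall l', l' \in iota 0 (size h) ->
         `|H t (rcons s k) (y l' (nth 0%N h l')) - H t s (y l' (nth 0%N h l'))|
           < theta (size h)).
have [m hm] : exists m : nat -> nat, forall l, E (mkseq m l) (m l).
  apply: history_choice => h; apply: (@filter_ex _ U).
  suff h1 : \forall k \near U, forall t, t \in act (size h) -> forall s, subseq s h ->
      `|H t s (y (size h) k)| < theta (size h) /\
       ((size s < N t)%N -> forall l', l' \in iota 0 (size h) ->
         `|H t (rcons s k) (y l' (nth 0%N h l')) - H t s (y l' (nth 0%N h l'))|
           < theta (size h)).
    have h2 : \forall k \near U, (L h <= k)%N by apply: ooU; exists (L h).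
    by apply: filterS (filterI h2 h1) => k [].
  apply: filter_forall_seq => t _; apply: filter_forall_subseq => s _.
  have [cH _ limH] := hH t.
  suff h1 : \forall k \near U, (size s < N t)%N -> forall l', l' \in iota 0 (size h) ->
         `|H t (rcons s k) (y l' (nth 0%N h l')) - H t s (y l' (nth 0%N h l'))|
           < theta (size h).
    have /cvgrPdist_lt/(_ _ (th0 (size h))) := ynull (size h) _ (cH s).
    move=> /ooU h2; apply: filterS (filterI h2 h1) => k [].
    by rewrite /= sub0r normrN.
  have [sN|sN] := ltnP (size s) (N t); last first.
    by apply: filterE => k.
  have := @filter_forall_seq _ _ U (iota 0 (size h)) (fun l' k =>
    `|H t (rcons s k) (y l' (nth 0%N h l')) - H t s (y l' (nth 0%N h l'))|
           < theta (size h)) (@filter_filter _ _ PU) (fun l' _ => limH s _ _ sN (th0 _)).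
  by move=> h3; apply: filterS h3 => k hk _.
exists m; split=> [l|t b J s sN bact]; first by have [] := hm l.
have [cH Hf _] := hH t.
pose S l := [seq m i | i <- iota 0 l & b i].
have Ssub l : subseq (S l) (mkseq m l) by apply/map_subseq/filter_subseq.
have SS l : S l.+1 = if b l then rcons (S l) (m l) else S l.
  rewrite /S -addn1 iotaD filter_cat map_cat /= add0n; case: (b l) => /=.
    by rewrite cats1.
  by rewrite cats0.
have Slt l : (l < J)%N -> b l -> (size (S l) < N t)%N.
  move=> lJ bl; rewrite -sN /s -(subnKC lJ) iotaD filter_cat map_cat size_cat.
  by rewrite -/(S l.+1) SS bl size_rcons leq_addr.
have hnull l : t \in act l -> `|H t (S l) (y l (m l))| < theta l /\
    `|H t [::] (y l (m l))| < theta l.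
  move=> tl; have [_ hl] := hm l; rewrite size_mkseq in hl.
  by split; [have [] := hl t tl _ (Ssub l) | have [] := hl t tl _ (sub0seq _)].
pose g u := H t (S J) u - H t [::] u.
have step l0 l : (l0 < l)%N -> (l < J)%N ->
    `|H t (S l.+1) (y l0 (m l0)) - H t (S l) (y l0 (m l0))| <= theta l.
  move=> l0l lJ; rewrite SS; case: ifPn => bl; last first.
    by rewrite subrr normr0 ltW.
  have [_ hl] := hm l; rewrite size_mkseq in hl.
  have [_ /(_ (Slt _ lJ bl) l0)] := hl t (bact _ bl) _ (Ssub l).
  by rewrite mem_iota add0n l0l nth_mkseq// => /(_ isT)/ltW.
have tele l0 n : (l0 < n)%N -> (n <= J)%N ->
    `|H t (S n) (y l0 (m l0)) - H t (S l0.+1) (y l0 (m l0))|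
      <= \sum_(l0.+1 <= l' < n) theta l'.
  elim: n => // n IH; rewrite ltnS leq_eqVlt => /predU1P[->|l0n] nJ.
    by rewrite subrr normr0 big_geq.
  rewrite big_nat_recr//= -[X in `|X|](subrKA (H t (S n) (y l0 (m l0)))) addrC.
  apply: (le_trans (ler_normD _ _)); apply: lerD; first exact: step.
  by apply: IH => //; exact: ltnW.
exists g; split.
- by move=> a u v; rewrite /g !(cH _).1; ring.
- move=> u; apply: (le_trans (ler_normB _ _)).
  by rewrite mulr_natl mulr2n lerD// (cH _).2.
- move=> l lJ bl; rewrite /g -Hf// addrAC subrr sub0r normrN thE ltW//.
  by have [_ /lt_le_trans->//] := hnull l (bact _ bl); rewrite lerDr mulr_ge0// ltW.
- move=> l lJ bl; rewrite thE; have := tele l J lJ (leqnn _).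
  rewrite SS (negbTE bl) => /le_trans/(_ (_ : _ <= theta l)) tl0.
  have {tl0}tl := tl0 (geometric_tail_le l J d0).
  have [/hnull[h1 h2]|tact] := boolP (t \in act l).
    rewrite /g -(subrKA (H t (S l) (y l (m l)))) addrC.
    apply: (le_trans (ler_normD _ _)); apply: lerD => //.
    apply: (le_trans (ler_normB _ _)).
    by rewrite mulr_natl mulr2n lerD// ltW.
  have -> : g (y l (m l)) = H t (S J) (y l (m l)) - H t (S l) (y l (m l)).
    rewrite /g /S; congr (_ - H t _ _); rewrite (@eq_in_filter _ _ pred0) ?filter_pred0//.
    move=> i; rewrite mem_iota add0n => /andP[_ il]; apply/negbTE/negP => /bact.
    by move/(actS _ _ (ltnW il)); apply/negP.
  by apply: (le_trans tl); rewrite lerDr mulr_ge0// ltW.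
Qed.

End decoupling.

(** * Spreading models *)

Section spreading.
Context {R : realType} {X Y : normedModType R} (x : nat -> X) (xt : nat -> Y).

(** The error in the definition of a spreading model is controlled by the number
    of terms.  Padding with zero coefficients far out makes the number of terms
    as large as desired, so that even short sums are approximated arbitrarily
    well. *)
Lemma spreading_transfer (n0 : nat) (C e : R) : has_spreading_model x xt -> 0 < e ->
  exists L, forall (s : seq nat) (a : nat -> R), sorted ltn s ->
    (forall k, k \in s -> (L <= k)%N) -> (size s <= n0)%N ->
    (forall i, (i < size s)%N -> `|a i| <= C) ->
    `| `|\sum_(i < size s) a i *: x (nth 0%N s i)| - `|\sum_(i < size s) a i *: xt i| |
      <= e.
Proof.
move=> [_ _ [eps [_ eps0 heps]]] e0.
pose D := `|C| + 1; have D0 : 0 < D by rewrite ltr_wpDl.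
have /cvgrPdist_lt/(_ _ (divr_gt0 e0 D0))[n1 _ hn1] := eps0.
pose n := maxn n0 n1; exists n => s a ss sL sn aC.
have sn' : (size s <= n)%N by rewrite (leq_trans sn)// leq_maxl.
pose a' (i : 'I_n) := if (i < size s)%N then a i / D else 0.
pose k (i : 'I_n) := if (i < size s)%N then nth 0%N s i
                     else (n + \max_(j <- s) j + i.+1)%N.
have sumE (Z : normedModType R) (z : nat -> Z) (z' : 'I_n -> Z) :
    (forall i : 'I_n, (i < size s)%N -> z' i = z i) ->
    `|\sum_(i < n) a' i *: z' i| = `|\sum_(i < size s) a i *: z i| / D.
  move=> zz; rewrite (big_ord_widen n (fun i => a i *: z i) sn').
  rewrite -[RHS]mulrC -[X in X * _]gtr0_norm ?invr_gt0// -normrZ scaler_sumr.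
  rewrite [in RHS]big_mkcond /=; congr (`|_|); apply: eq_bigr => i _.
  rewrite /a'; case: ifPn => isz; last by rewrite scale0r.
  by rewrite zz// scalerA mulrC.
have ks i : (i < size s)%N -> (nth 0%N s i <= \max_(j <- s) j)%N.
  by move=> isz; rewrite (@leq_bigmax_seq _ _ _ id)// mem_nth.
have : `| `|\sum_(i < n) a' i *: x (k i)| - `|\sum_(i < n) a' i *: xt i| | < eps n.
  apply: heps.
  - move=> i; rewrite -ler_norml /a'; case: ifP => isz; last by rewrite normr0.
    rewrite normrM normfV (gtr0_norm D0) ler_pdivrMr// mul1r.
    by rewrite (le_trans (aC _ isz))// /D (le_trans (ler_norm _))// lerDl.
  - move=> i; rewrite /k; case: ifP => isz; last by lia.
    by rewrite leqW// sL// mem_nth.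
  - move=> i j ij; rewrite /k; case: ifPn => isz; case: ifPn => jsz.
    + by rewrite (sorted_ltn_nth ltn_trans).
    + by have := ks _ isz; lia.
    + by lia.
    + by lia.
rewrite (sumE _ (fun i => x (nth 0%N s i)) (fun i => x (k i))); last first.
  by move=> i isz; rewrite /k isz.
rewrite (sumE _ xt (fun i : 'I_n => xt i))// -mulrBl normrM normfV (gtr0_norm D0).
rewrite ltr_pdivrMr// => h; apply/ltW/(lt_le_trans h); rewrite -ler_pdivlMr//.
have := hn1 n (leq_maxr _ _); rewrite /= sub0r normrN => h1; apply/ltW.
by apply: le_lt_trans h1; exact: ler_norm.
Qed.

Hypotheses (hsm : has_spreading_model x xt) (wx : weakly_null x).

Lemma contractive_cvg0 (F : X -> R) : contractive F -> F (x k) @[k --> \oo] --> 0.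
Proof.
move=> [Flin Fle].
have lF : linear (F : X -> R^o) by move=> a u v; rewrite Flin.
pose F' : {linear X -> R^o} := HB.pack F (GRing.isLinear.Build R X R^o *:%R F lF).
apply: (wx (f := F')) => u; apply/cvgrPdist_lt => e e0.
near=> v; rewrite -linearB; apply: le_lt_trans (Fle _) _.
by near: v; apply: cvgr_dist_lt.
Unshelve. all: by end_near. Qed.

(** A functional norming the part of the sum indexed by [P] is decoupled from
    the other terms, which are then no obstruction. *)
Lemma spreading_suppression (n : nat) (a : nat -> R) (P : pred nat) :
  `|\sum_(i < n | P i) a i *: xt i| <= 2 * `|\sum_(i < n) a i *: xt i|.
Proof.
pose C := \sum_(i < n) `|a i|.
have C0 : 0 <= C by exact: sumr_ge0.
apply/ler_addgt0Pl => e e0.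
pose a0 i := if (i < n)%N then a i else 0.
have a0C i : `|a0 i| <= C.
  rewrite /a0; case: ifP => [ni|_]; last by rewrite normr0.
  by rewrite /C (bigD1 (Ordinal ni))//= lerDl sumr_ge0.
pose a1 i := if P i then a0 i else 0.
have a1C i : `|a1 i| <= C by rewrite /a1; case: ifP => _//; rewrite normr0.
have e4 : 0 < e / 4 by rewrite divr_gt0.
have [L hL] := spreading_transfer n C hsm e4.
pose Ps := [seq i <- iota 0 n | P i].
pose vec (s : seq nat) := \sum_(q <- zip Ps s) a q.1 *: x q.2.
have /choice[f hf] s : exists f, contractive f /\ f (vec s) = `|vec s|.
  exact: norming_functional.
pose d := e / (12 * (C + 1)).
have d0 : 0 < d by rewrite divr_gt0// mulr_gt0// ltr_wpDl.
have [||||m [mL hm]] := @decoupling R X unit (fun=> [:: tt]) (fun=> size Ps)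
  (fun _ => f) (fun _ => x) (fun h => (\max_(k <- h) k).+1) d.
- by [].
- by [].
- by move=> _ F; exact: contractive_cvg0.
- by move=> _ s; have [] := hf s.
have mS i j : (i < j)%N -> (m i < m j)%N.
  move=> ij; apply: leq_trans (mL j); rewrite ltnS.
  by rewrite (@leq_bigmax_seq _ _ _ id)//; apply: map_f; rewrite mem_iota.
have mge i : (i <= m i)%N by elim: i => // i /leq_ltn_trans; apply; apply: mS.
pose b l := (L <= l)%N && (l - L < n)%N && P (l - L)%N.
have sE : [seq m l | l <- iota 0 (L + n) & b l] = [seq m (L + i)%N | i <- Ps].
  rewrite iotaD filter_cat add0n (@eq_in_filter _ b pred0); last first.
    by move=> l; rewrite mem_iota /b => /andP[_]; case: leqP.
  rewrite filter_pred0/= -{1}[L]addn0 iotaDl filter_map -map_comp; congr map.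
  apply: eq_in_filter => i; rewrite mem_iota /b add0n => /andP[_ i_n] /=.
  by rewrite leq_addr addKn i_n.
have [||g [glin gle gsel gun]] := hm tt b (L + n)%N.
- by rewrite sE size_map.
- by [].
rewrite /= sE in gsel.
pose s := [seq m (L + i)%N | i <- iota 0 n].
have szs : size s = n by rewrite size_map size_iota.
have nths (i : 'I_n) : nth 0%N s i = m (L + i)%N.
  by rewrite (nth_map 0%N) ?size_iota// nth_iota.
have h (a' : nat -> R) : (forall i, `|a' i| <= C) ->
    `| `|\sum_(i < n) a' i *: x (m (L + i)%N)| - `|\sum_(i < n) a' i *: xt i| | <= e / 4.
  move=> a'C; have := hL s a' _ _ _ (fun i _ => a'C i).
  rewrite szs (eq_bigr (fun i : 'I_n => a' i *: x (m (L + i)%N))); last first.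
    by move=> i _; rewrite nths.
  apply=> //.
  - apply/(sortedP 0%N) => i; rewrite szs => iS.
    have i_n := ltnW iS.
    rewrite !(nth_map 0%N) ?size_iota// !nth_iota// !add0n.
    by apply: mS; rewrite ltn_add2l.
  - by move=> _ /mapP[i _ ->]; rewrite (leq_trans (leq_addr i L))// mge.
have /ler_normlP[h1 _] := h a1 a1C; have /ler_normlP[_ h0] := h a0 a0C.
have E0 (z : nat -> Y) : \sum_(i < n) a0 i *: z i = \sum_(i < n) a i *: z i.
  by apply: eq_bigr => i _; rewrite /a0 ltn_ord.
have E1 (Z : normedModType R) (z : nat -> Z) :
    \sum_(i < n) a1 i *: z i = \sum_(i < n | P i) a i *: z i.
  rewrite [RHS]big_mkcond; apply: eq_bigr => i _; rewrite /a1 /a0 ltn_ord.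
  by case: ifP; rewrite // scale0r.
have E0' (z : nat -> X) : \sum_(i < n) a0 i *: z i = \sum_(i < n) a i *: z i.
  by apply: eq_bigr => i _; rewrite /a0 ltn_ord.
rewrite E0 (E0' (fun i => x (m (L + i)%N))) in h0.
rewrite (E1 _ xt) (E1 _ (fun i => x (m (L + i)%N))) in h1.
pose z i := x (m (L + i)%N).
have vecE : vec [seq m (L + i)%N | i <- Ps] = \sum_(i < n | P i) a i *: z i.
  rewrite /vec -[X in zip X _]map_id zip_map big_map/= big_filter.
  by rewrite -[n in iota 0 n]subn0 -/(index_iota 0 n) big_mkord.
have hP : `|\sum_(i < n | P i) a i *: z i| <= 2 * `|\sum_(i < n) a i *: z i| + e / 4.
  have [[Flin _] FE] := hf [seq m (L + i)%N | i <- Ps].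
  set F := f [seq m (L + i)%N | i <- Ps] in Flin FE.
  rewrite -vecE -FE vecE -lerBlDl.
  apply: (@le_trans _ _ (F (\sum_(i < n | P i) a i *: z i) - g (\sum_(i < n) a i *: z i))).
    by rewrite lerD2l lerN2 (le_trans (ler_norm _)).
  rewrite (functional_sum Flin) (functional_sum glin) big_mkcond -sumrB.
  apply: (@le_trans _ _ (\sum_(i < n) `|a i| * (3 * d))).
    apply: ler_sum => i _; apply: (le_trans (ler_norm _)).
    have dle l : 3 * d * 2^-1 ^+ l <= 3 * d.
      have d3 : 0 <= 3 * d by rewrite mulr_ge0// ltW.
      by apply: (ler_piMr d3); apply: half_expn_le1.
    have lJ : (L + i < L + n)%N by rewrite ltn_add2l.
    case: ifPn => Pi.
      rewrite -mulrBr normrM ler_wpM2l// distrC.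
      apply: le_trans (dle (L + i)%N); apply: gsel => //.
      by rewrite /b leq_addr addKn ltn_ord.
    rewrite sub0r normrN normrM ler_wpM2l//.
    apply: le_trans (dle (L + i)%N); apply: gun => //.
    by rewrite /b addKn (negbTE Pi) andbF.
  rewrite -mulr_suml -/C /d.
  have -> : C * (3 * (e / (12 * (C + 1)))) = e / 4 * (C / (C + 1)).
    by field; rewrite gt_eqF// ltr_wpDl.
  by rewrite ler_piMr ?ltW// ltr_pdivrMr ?mul1r ?ltrDl// ltr_wpDl.
rewrite -/z in h0 h1.
have : 2 * `|\sum_(i < n) a i *: z i| <= 2 * (`|\sum_(i < n) a i *: xt i| + e / 4).
  by rewrite ler_wpM2l//; lra.
by move: h1 hP; lra.
Qed.
End spreading.

Section growth.
Context {R : realType} {X Y : normedModType R} (x : nat -> X) (xt : nat -> Y).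
Hypotheses (hsm : has_spreading_model x xt) (wx : weakly_null x).

Lemma normalized_spreading_model i : normalized x -> `|xt i| = 1.
Proof.
move=> nx; apply/eqP; rewrite -subr_eq0 -normr_le0; apply/ler_addgt0Pl => e e0.
have [L hL] := spreading_transfer i.+1 1 hsm e0.
have := hL (iota L i.+1) (fun j => (j == i)%:R).
have E (Z : normedModType R) (z : nat -> Z) :
    \sum_(j < i.+1) (j == i :> nat)%:R *: z j = z i.
  rewrite big_ord_recr /= eqxx scale1r big1 ?add0r// => j _.
  by rewrite ltn_eqF// scale0r.
rewrite size_iota (E _ xt) (E _ (fun j => x (nth 0%N (iota L i.+1) j))) nx addr0 distrC.
apply=> //; first exact: iota_ltn_sorted.
- by move=> k; rewrite mem_iota => /andP[].
- by move=> j _; case: (j == i); rewrite ?normr1 ?normr0.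
Qed.

(** If sums of [N] terms with coefficients in [[-1, 1]] can have norm larger than
    [e * N] for all [N], then a norming functional is at least [e / 4] in
    absolute value on a proportion of the terms, and of a constant sign on half
    of these.  By subsymmetry this gives a lower l_1 estimate for nonnegative
    coefficients, which suppression extends to all coefficients. *)
Lemma not_l1_sublinear (e : R) : normalized x -> ~ equiv_l1_basis xt -> 0 < e ->
  exists N : nat, (0 < N)%N /\ forall b : nat -> R, (forall i, `|b i| <= 1) ->
    `|\sum_(i < N) b i *: xt i| <= e * N%:R.
Proof.
move=> nx nl1 e0; apply: contrapT => /forallNP hN; apply: nl1.
have {hN}hN (N : nat) : (0 < N)%N -> exists2 b : nat -> R, forall i, `|b i| <= 1 &
    e * N%:R < `|\sum_(i < N) b i *: xt i|.
  move=> N0; apply: contrapT => nb; apply: (hN N); split=> // b b1.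
  by rewrite leNgt; apply/negP => h; apply: nb; exists b.
have pos n (a : nat -> R) : (forall i, 0 <= a i) ->
    e / 4 * \sum_(i < n) a i <= `|\sum_(i < n) a i *: xt i|.
  move=> a0; apply/ler_addgt0Pl => d d0.
  (* At least [e * N / 4] terms survive once small values and one sign are discarded. *)
  pose N := (Num.bound (4 * n%:R / e)).+1.
  have nN : n%:R <= e * N%:R / 4.
    have /ltW : 4 * n%:R / e < N%:R.
      apply: lt_le_trans (archi_boundP _) _; last by rewrite ler_nat.
      by rewrite divr_ge0 ?mulr_ge0// ltW.
    by rewrite ler_pdivrMr//; lra.
  have [b b1 hb] := hN N isT.
  have [L1 hL1] := spreading_transfer N 1 hsm (divr_gt0 e0 (ltr0n _ 4)).
  have [L2 hL2] := spreading_transfer n (\sum_(i < n) a i) hsm d0.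
  pose L := maxn L1 L2; pose s := iota L N.
  pose v := \sum_(k <- s) b (k - L)%N *: x k.
  have [f [[flin fle] fv]] := norming_functional v.
  have f1 k : `|f (x k)| <= 1 by rewrite -(nx k).
  have vE : v = \sum_(i < N) b i *: x (nth 0%N s i).
    rewrite /v (big_nth 0%N) big_mkord size_iota; apply: eq_bigr => i _.
    by rewrite nth_iota// addKn.
  have nv : 3 / 4 * (e * N%:R) < f v.
    rewrite fv vE; have := hL1 s b; rewrite size_iota.
    move=> /(_ _ _ (leqnn _) (fun i _ => b1 i)) /ler_normlP h.
    have [] := h.
    - exact: iota_ltn_sorted.
    - by move=> k; rewrite mem_iota => /andP[+ _]; apply: leq_trans; rewrite leq_maxl.
    have : 1 <= N%:R :> R by rewrite ler1n.
    move: hb; nra.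
  pose B (tau : R) := [seq k <- s | e / 4 <= tau * f (x k)].
  have cB : e * N%:R / 2 <= (size (B 1))%:R + (size (B (- 1)%R))%:R.
    have : f v <= \sum_(k <- s) ((e / 4 <= 1 * f (x k))%R%:R +
        (e / 4 <= (-1) * f (x k))%R%:R + e / 4).
      rewrite (functional_sum flin); apply: ler_sum => k _.
      have bf : b (k - L)%N * f (x k) <= `|f (x k)|.
        by apply: le_trans (ler_norm _) _; rewrite normrM ler_piMl.
      apply: (le_trans bf); rewrite mul1r mulN1r.
      have fk := f1 k; have [f0|f0] := ger0P (f (x k)).
      - rewrite ger0_norm// in fk.
        case: (lerP (e / 4) (f (x k))) => h1; case: (lerP (e / 4) (- f (x k))) => h2 /=; lra.
      - rewrite ltr0_norm// in fk.
        case: (lerP (e / 4) (f (x k))) => h1; case: (lerP (e / 4) (- f (x k))) => h2 /=; lra.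
    have cnt (p : pred nat) : \sum_(k <- s) (p k)%:R = (size [seq k <- s | p k])%:R :> R.
      rewrite -sum1_size natr_sum big_filter [RHS]big_mkcond.
      by apply: eq_bigr => k _; case: (p k).
    rewrite !big_split/= !cnt big_const_seq count_predT size_iota iter_addr_0.
    by rewrite -/(B 1) -/(B (-1)) -[_ *+ N]mulr_natr; move: nv; lra.
  have [tau tau1 nB] : exists2 tau : R, `|tau| <= 1 & (n <= size (B tau))%N.
    have [h|h] := leP (n%:R : R) (size (B 1))%:R.
      by exists 1; rewrite ?normr1// -(ler_nat R).
    exists (-1); first by rewrite normrN normr1.
    by rewrite -(ler_nat R); move: nN cB h; lra.
  pose l := take n (B tau).
  have szl : size l = n by rewrite size_takel.
  have sl : subseq l s by rewrite (subseq_trans (take_subseq _ _))// filter_subseq.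
  have := hL2 l a; rewrite szl => h2.
  have [|||_ h] := ler_normlP _ _ (h2 _ _ (leqnn n) _).
  - by apply: (subseq_sorted ltn_trans sl); exact: iota_ltn_sorted.
  - move=> k /(mem_subseq sl); rewrite mem_iota => /andP[+ _].
    by apply: leq_trans; rewrite leq_maxr.
  - move=> i i_n; rewrite ger0_norm// (bigD1 (Ordinal i_n))//= lerDl.
    by apply: sumr_ge0.
  suff : e / 4 * \sum_(i < n) a i <= `|\sum_(i < n) a i *: x (nth 0%N l i)|.
    by move: h; lra.
  set w := \sum_(i < n) _ in h *; apply: (@le_trans _ _ (tau * f w)); last first.
    apply: (le_trans (ler_norm _)); rewrite normrM.
    by apply: le_trans (fle w); rewrite ler_piMl.
  rewrite /w (functional_sum flin) !mulr_sumr; apply: ler_sum => i _.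
  rewrite mulrCA [e / 4 * _]mulrC ler_wpM2l//.
  have : nth 0%N l i \in B tau.
    by apply: (mem_subseq (take_subseq (B tau) n)); rewrite mem_nth// szl.
  by rewrite mem_filter => /andP[].
exists (e / 16), 1; split=> [||n a]; [by rewrite divr_gt0 | by [] |].
have -> : lp_norm 1%E a = \sum_(i < n) `|a i|.
  by rewrite /lp_norm invr1 powRr1 ?sumr_ge0//; apply: eq_bigr => i _; rewrite powRr1.
apply/andP; split; last first.
  rewrite mul1r (le_trans (ler_norm_sum _ _ _))//; apply: ler_sum => i _.
  by rewrite normrZ (normalized_spreading_model _ nx) mulr1.
pose a' i := if insub i is Some j then a j else 0.
have a'E (i : 'I_n) : a' i = a i by rewrite /a' valK.
rewrite (eq_bigr (fun i : 'I_n => `|a' i|)); last by move=> i _; rewrite a'E.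
rewrite (eq_bigr (fun i : 'I_n => a' i *: xt i)); last by move=> i _; rewrite a'E.
have half (c : nat -> R) :
    e / 4 * \sum_(i < n) Num.max (c i) 0 <= 2 * `|\sum_(i < n) c i *: xt i|.
  apply: le_trans (spreading_suppression hsm wx _ _ (fun i => 0 <= c i)).
  apply: (le_trans (pos n (fun i => Num.max (c i) 0) _)).
    by move=> i; rewrite le_max lexx orbT.
  rewrite [X in _ <= `|X|]big_mkcond/= le_eqVlt; apply/orP; left; apply/eqP.
  congr (`|_|); apply: eq_bigr => i _; have [c0|c0] := leP 0 (c i) => //.
  by rewrite scale0r.
have h1 := half a'; have := half (fun i => - a' i).
rewrite (eq_bigr (fun i : 'I_n => - (a' i *: xt i))); last by move=> i _; rewrite scaleNr.
rewrite sumrN normrN => h2.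
have -> : \sum_(i < n) `|a' i| =
    \sum_(i < n) Num.max (a' i) 0 + \sum_(i < n) Num.max (- a' i) 0.
  rewrite -big_split; apply: eq_bigr => i _ /=; have [c0|c0] := ler0P (a' i).
    by rewrite add0r; have [|] := leP (- a' i) 0; lra.
  by have [|] := leP (- a' i) 0; lra.
by move: h1 h2; lra.
Qed.

(** Order the terms by decreasing absolute value of the coefficient and cut them
    into groups of [N].  The norm of a group is at most [e * N] times its largest
    coefficient, hence at most [e] times the sum of the coefficients of the
    preceding group; the term [N * M] pays for the first group. *)
Lemma sublinear_sums (e : R) : normalized x -> ~ equiv_l1_basis xt -> 0 < e ->
  exists N L : nat, forall (r : seq nat) (pos : nat -> nat) (a : nat -> R) (M : R),
    uniq (map pos r) -> (forall j, j \in r -> (L <= pos j)%N) ->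
    0 <= M -> (forall j, j \in r -> `|a j| <= M) ->
    `|\sum_(j <- r) a j *: x (pos j)| <= e * (\sum_(j <- r) `|a j| + N%:R * M).
Proof.
move=> nx nl1 e0; have e2 : 0 < e / 2 by rewrite divr_gt0.
have [N [N0 hN]] := not_l1_sublinear nx nl1 e2.
have [L hL] := spreading_transfer N 1 hsm e2.
exists N, L => r pos a.
have base r' M : uniq (map pos r') -> (forall j, j \in r' -> (L <= pos j)%N) ->
    0 <= M -> (forall j, j \in r' -> `|a j| <= M) -> (size r' <= N)%N ->
    `|\sum_(j <- r') a j *: x (pos j)| <= e * (N%:R * M).
  move=> ur rL M0 aM rN; move: M0; rewrite le_eqVlt => /predU1P[M0|M0].
    rewrite -M0 !mulr0 big_seq big1 ?normr0// => j /aM.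
    by rewrite -M0 normr_le0 => /eqP->; rewrite scale0r.
  pose le_pos i j := (pos i <= pos j)%N.
  pose q := sort le_pos r'; pose s := map pos q.
  have szs : size s = size q by rewrite size_map.
  have szq : (size q <= N)%N by rewrite size_sort.
  have ss : sorted ltn s.
    rewrite ltn_sorted_uniq_leq (perm_uniq (s2 := map pos r')) ?ur; last first.
      by apply: perm_map; rewrite perm_sort.
    by rewrite sorted_map; apply: sort_sorted => i j; exact: leq_total.
  pose a' i := if (i < size q)%N then a (nth 0%N q i) / M else 0.
  have a'1 i : `|a' i| <= 1.
    rewrite /a'; case: ifP => [iq|_]; last by rewrite normr0.
    rewrite normrM normfV (gtr0_norm M0) ler_pdivrMr// mul1r aM//.
    by rewrite -(mem_sort le_pos) mem_nth.
  have sL k : k \in s -> (L <= k)%N.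
    by move=> /mapP[j jq ->]; apply: rL; rewrite -(mem_sort le_pos).
  have := hL s a' ss sL; rewrite szs => /(_ szq (fun i _ => a'1 i)) /ler_normlP[_].
  have -> : \sum_(i < size q) a' i *: x (nth 0%N s i)
      = M^-1 *: \sum_(j <- r') a j *: x (pos j).
    have pq : perm_eq r' q by rewrite perm_sym perm_sort.
    rewrite (perm_big _ pq).
    rewrite (big_nth 0%N) big_mkord scaler_sumr; apply: eq_bigr => i _.
    by rewrite /a' ltn_ord (nth_map 0%N)// scalerA mulrC.
  have -> : \sum_(i < size q) a' i *: xt i = \sum_(i < N) a' i *: xt i.
    rewrite (big_ord_widen N (fun i => a' i *: xt i) szq) [LHS]big_mkcond.
    by apply: eq_bigr => i _; rewrite /a'; case: ifP => [->|_]; rewrite ?scale0r.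
  rewrite normrZ gtr0_norm ?invr_gt0// => hs.
  have {hs} : M^-1 * `|\sum_(j <- r') a j *: x (pos j)| <= e * N%:R.
    have : 1 <= N%:R :> R by rewrite ler1n.
    by have := hN a' a'1; move: hs; nra.
  by rewrite ler_pdivrMl// mulrC mulrA.
pose bigger i j := `|a j| <= `|a i|.
have main n : forall r' M, (size r' < n)%N -> pairwise bigger r' ->
    uniq (map pos r') -> (forall j, j \in r' -> (L <= pos j)%N) ->
    0 <= M -> (forall j, j \in r' -> `|a j| <= M) ->
    `|\sum_(j <- r') a j *: x (pos j)| <= e * (\sum_(j <- r') `|a j| + N%:R * M).
  elim: n => // n IH r' M; rewrite ltnS => rn pr ur rL M0 aM.
  have [rN|Nr] := leqP (size r') N.
    apply: (le_trans (base _ _ ur rL M0 aM rN)).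
    by rewrite ler_wpM2l ?(ltW e0)// lerDr sumr_ge0.
  have szt := size_takel (ltnW Nr); have Nr' := Nr.
  move: Nr; rewrite -subn_gt0 -size_drop; case dr : (drop N r') => [|h t] // _.
  have rE : r' = take N r' ++ h :: t by rewrite -dr cat_take_drop.
  move: ur pr; rewrite rE map_cat cat_uniq pairwise_cat => /and3P[ut _ uh].
  move=> /and3P[/allrelP tb _ pb].
  rewrite !big_cat/=.
  have tr j : j \in take N r' -> j \in r' by move=> jt; rewrite rE mem_cat jt.
  have hr j : j \in h :: t -> j \in r' by move=> jt; rewrite rE mem_cat jt orbT.
  have h1 : `|\sum_(j <- take N r') a j *: x (pos j)| <= e * (N%:R * M).
    by apply: base => // [j /tr/rL|j /tr/aM|]//; rewrite szt.
  have h2 : `|\sum_(j <- h :: t) a j *: x (pos j)|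
      <= e * (\sum_(j <- h :: t) `|a j| + N%:R * `|a h|).
    apply: IH => // [|j /hr/rL|j]//.
      by rewrite -dr size_drop; move: rn Nr' N0; lia.
    rewrite inE => /predU1P[->//|jt].
    by move: pb => /= /andP[/allP/(_ _ jt)].
  have h3 : N%:R * `|a h| <= \sum_(j <- take N r') `|a j|.
    rewrite -{1}szt mulr_natl -iter_addr_0 -count_predT -big_const_seq.
    rewrite big_seq [leRHS]big_seq; apply: ler_sum => j jt.
    by apply: tb; rewrite ?mem_head.
  apply: (le_trans (ler_normD _ _)); apply: (le_trans (lerD h1 h2)).
  by rewrite -mulrDr ler_wpM2l ?(ltW e0)//; move: h3; lra.
move=> M ur rL M0 aM; pose q := sort bigger r.
have pq : perm_eq r q by rewrite perm_sym perm_sort.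
rewrite !(perm_big _ pq)/=; apply: (main (size q).+1) => //.
- rewrite -sorted_pairwise; first by apply: sort_sorted => i j; exact: le_total.
  by move=> i j k; rewrite /bigger => h1 h2; exact: le_trans h2 h1.
- by rewrite -(perm_uniq (perm_map pos pq)).
- by move=> j; rewrite -(perm_mem pq); exact: rL.
- by move=> j; rewrite -(perm_mem pq); exact: aM.
Qed.

End growth.

(** * Blocks that behave like the basis of l_1 *)

Section krivine.
Context {R : realType} {X Y : normedModType R} (x : nat -> X) (xt : nat -> Y).
Hypotheses (hsm : has_spreading_model x xt).

Definition block (V : lmodType R) (z : nat -> V) (lam : seq R) (mu : nat) : V :=
  \sum_(k < size lam) lam`_k *: z (mu + k)%N.

Lemma big_ord_mul (V : nmodType) (n m : nat) (F : nat -> V) :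
  \sum_(q < n * m) F q = \sum_(i < n) \sum_(k < m) F (i * m + k)%N.
Proof.
elim: n => [|n IH]; first by rewrite !big_ord0.
by rewrite mulSnr big_split_ord big_ord_recr /= IH.
Qed.

(** A functional norming a signed sum of [n] blocks has value almost [n] on it
    and at most [1 + 2 * e] on each block, so with [e] of order [1 / n] it is at
    least [3 / 4] on every block, up to the sign. *)
Lemma krivine_block (n : nat) : (0 < n)%N -> Krivine_set xt 1%E ->
  exists (lam : seq R) (L : nat),
    (forall mu, (L <= mu)%N -> `|block x lam mu| <= 2) /\
    forall (s : seq nat) (sg : seq bool), size s = n ->
      sorted (fun i j => i + size lam <= j)%N s -> (forall mu, mu \in s -> (L <= mu)%N) ->
      exists f, contractive f /\
        forall t, (t < n)%N -> 3 / 4 <= (-1) ^+ nth false sg t * f (block x lam (nth 0%N s t)).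
Proof.
move=> n0 [_ hK]; pose e : R := (16 * n%:R)^-1.
have n1 : 1 <= n%:R :> R by rewrite ler1n.
have e0 : 0 < e by rewrite invr_gt0; lra.
have en : e * n%:R = 16^-1 by rewrite /e; field; lra.
have [m [lam0 hlam]] := hK e n e0.
pose lam' k := if insub k is Some i then lam0 i else 0.
have lam'E (k : 'I_m) : lam' k = lam0 k by rewrite /lam' valK.
pose lam := mkseq lam' m.
have szl : size lam = m by rewrite size_mkseq.
have lamE (k : 'I_m) : lam`_k = lam0 k by rewrite nth_mkseq// lam'E.
have lp1 (a : 'I_n -> R) : lp_norm 1%E a = \sum_(i < n) `|a i|.
  by rewrite /lp_norm invr1 powRr1 ?sumr_ge0//; apply: eq_bigr => i _; rewrite powRr1.
have yE (i : nat) : \sum_(k < m) lam0 k *: xt (i * m + k)%N = block xt lam (i * m).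
  by rewrite /block szl; apply: eq_bigr => k _; rewrite lamE.
have {}hlam (a : nat -> R) : (1 + e)^-1 * \sum_(i < n) `|a i|
    <= `|\sum_(i < n) a i *: block xt lam (i * m)| <= (1 + e) * \sum_(i < n) `|a i|.
  have := hlam (fun i => a i); rewrite lp1.
  by rewrite (eq_bigr (fun i : 'I_n => a i *: block xt lam (i * m)))// => i _; rewrite yE.
pose C := \sum_(k < m) `|lam`_k|.
have lamC k : (k < m)%N -> `|lam`_k| <= C.
  by move=> km; rewrite /C (bigD1 (Ordinal km))//= lerDl sumr_ge0.
have [L hL] := spreading_transfer (n * m) C hsm e0.
have iotaL mu k : (L <= mu)%N -> k \in iota mu m -> (L <= k)%N.
  by move=> Lmu; rewrite mem_iota => /andP[+ _]; apply: leq_trans.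
have nblock mu : (L <= mu)%N -> `|block x lam mu| <= 1 + 2 * e.
  move=> Lmu; have := hL (iota mu m) (fun k => lam`_k); rewrite size_iota.
  move=> /(_ (iota_ltn_sorted _ _) (fun k => @iotaL mu k Lmu) (leq_pmull m n0) lamC).
  have -> : \sum_(k < m) lam`_k *: x (nth 0%N (iota mu m) k) = block x lam mu.
    by rewrite /block szl; apply: eq_bigr => k _; rewrite nth_iota.
  have -> : \sum_(k < m) lam`_k *: xt k = block xt lam (0 * m).
    by rewrite /block szl mul0n.
  move=> /ler_normlP[_].
  have := hlam (fun i => (i == 0%N)%:R); rewrite -[n]prednK// !big_ord_recl/=.
  rewrite !big1 => [|i _|i _]; rewrite ?scale0r ?normr0//.
  by rewrite normr1 scale1r !addr0 !mulr1 => /andP[_]; lra.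
exists lam, L; split.
  move=> mu /nblock/le_trans; apply.
  by have : e <= 16^-1; [rewrite -en ler_peMr// ltW|lra].
move=> s sg szs ss sL; rewrite szl in ss.
pose sgn t : R := (-1) ^+ nth false sg t.
have sgn1 t : `|sgn t| = 1 by rewrite normrX normrN normr1 expr1n.
pose K q := (nth 0%N s (q %/ m) + q %% m)%N.
pose v := \sum_(i < n) sgn i *: block x lam (nth 0%N s i).
have [f [[flin fle] fv]] := norming_functional v.
exists f; split=> //.
have fb t : (t < n)%N -> sgn t * f (block x lam (nth 0%N s t)) <= 1 + 2 * e.
  move=> tn; apply: (le_trans (ler_norm _)); rewrite normrM sgn1 mul1r.
  by apply: (le_trans (fle _)); apply/nblock/sL; rewrite mem_nth// szs.
have modE i (k : 'I_m) : ((i * m + k) %/ m = i /\ (i * m + k) %% m = k)%N.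
  have m0 : (0 < m)%N by apply: leq_ltn_trans (ltn_ord k).
  by rewrite divnMDl// divn_small// addn0 modnMDl modn_small.
have vE : v = \sum_(q < n * m) (sgn (q %/ m)%N * lam`_(q %% m)) *: x (K q).
  rewrite (big_ord_mul n m (fun q => (sgn (q %/ m)%N * lam`_(q %% m)) *: x (K q))).
  apply: eq_bigr => i _; rewrite /block szl scaler_sumr; apply: eq_bigr => k _.
  by rewrite /K (modE i k).1 (modE i k).2 scalerA.
have nv : n%:R * (1 - e) - e <= f v.
  pose a q : R := sgn (q %/ m)%N * lam`_(q %% m).
  have := hL (mkseq K (n * m)) a; rewrite size_mkseq.
  have h1 : sorted ltn (mkseq K (n * m)).
    apply/(sortedP 0%N) => q; rewrite size_mkseq => qS.
    rewrite !nth_mkseq//; last exact: ltnW.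
    have m0 : (0 < m)%N by move: qS; case: (m) => //; rewrite muln0.
    have := ltn_pmod q m0; rewrite leq_eqVlt => /predU1P[qm|qm].
      have qE : q.+1 = ((q %/ m).+1 * m)%N by rewrite {1}(divn_eq q m) mulSn; lia.
      have iS : ((q %/ m).+1 < n)%N by rewrite -(ltn_pmul2r m0) -qE.
      rewrite /K qE mulnK// modnMl addn0.
      have /(sortedP 0%N) /(_ (q %/ m)%N) := ss; rewrite szs => /(_ iS).
      by rewrite -{2}qm addnS; apply: leq_trans; rewrite ltnS.
    have qE : q.+1 = (q %/ m * m + (q %% m).+1)%N by rewrite {1}(divn_eq q m) addnS.
    suff -> : K q.+1 = (K q).+1 by rewrite /= ltnS.
    by rewrite /K qE divnMDl// [(_.+1 %/ m)%N]divn_small// addn0 modnMDl modn_small// addnS.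
  have h2 k : k \in mkseq K (n * m) -> (L <= k)%N.
    move=> /mapP[q]; rewrite mem_iota add0n => /andP[_ qnm] ->.
    rewrite /K (leq_trans (sL (nth 0%N s (q %/ m)) _)) ?leq_addr//.
    by rewrite mem_nth// szs ltn_divLR//; move: qnm; case: (m) => //; rewrite muln0.
  have h3 q : (q < n * m)%N -> `|a q| <= C.
    move=> qnm; rewrite /a normrM sgn1 mul1r; apply: lamC.
    by rewrite ltn_pmod//; move: qnm; case: (m) => //; rewrite muln0.
  move=> /(_ h1 h2 (leqnn _) h3) /ler_normlP[+ _].
  have -> : \sum_(q < n * m) a q *: x (nth 0%N (mkseq K (n * m)) q) = v.
    by rewrite vE; apply: eq_bigr => q _; rewrite nth_mkseq.
  have -> : \sum_(q < n * m) a q *: xt q = \sum_(i < n) sgn i *: block xt lam (i * m).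
    rewrite (big_ord_mul n m (fun q => a q *: xt q)).
    apply: eq_bigr => i _; rewrite /block szl scaler_sumr; apply: eq_bigr => k _.
    by rewrite /a (modE i k).1 (modE i k).2 scalerA.
  have /andP[+ _] := hlam sgn.
  rewrite (eq_bigr (fun _ => 1)) => [|i _]; last by rewrite sgn1.
  rewrite sumr_const card_ord fv.
  have : (1 - e) * n%:R <= (1 + e)^-1 * n%:R.
    rewrite ler_wpM2r// -[leRHS]mul1r ler_pdivlMr; last by lra.
    by nra.
  by lra.
move=> t tn; rewrite -/(sgn t).
have : f v <= sgn t * f (block x lam (nth 0%N s t)) + (n%:R - 1) * (1 + 2 * e).
  rewrite /v (functional_sum flin) (bigD1 (Ordinal tn))//= lerD2l.
  apply: (@le_trans _ _ (\sum_(i < n | i != Ordinal tn) (1 + 2 * e))).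
    by apply: ler_sum => i _; exact: fb.
  rewrite sumr_const cardC1 card_ord -(mulr_natl (1 + 2 * e)).
  by rewrite -subn1 natrB.
have := nv; move: en; nra.
Qed.

End krivine.

(** * Domination *)

Section domination.
Context {R : realType} {X : normedModType R}.

(** The order of magnitude of level [s] is a constant over [level_scale N L s],
    so small that the [s + L s] indices to which slow growth at level [s] does
    not apply, as well as the error term with [N s], contribute [O(2 ^ -s)]. *)
Definition level_scale (N L : nat -> nat) : nat -> nat :=
  fix D s := if s is s'.+1 then (2 * D s' * (1 + s + N s + L s))%N
             else (1 + N s + L s)%N.

Lemma enlarge_index_set (s n : nat) (r : seq nat) :
  uniq r -> (forall j, j \in r -> (s <= j)%N) -> (size r <= n)%N ->
  exists q, [/\ uniq (r ++ q), size (r ++ q) = n &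
    forall j, j \in r ++ q -> (s <= j)%N].
Proof.
move=> ur rs rn; exists (iota (s + \max_(j <- r) j.+1) (n - size r)); split.
- rewrite cat_uniq ur iota_uniq andbT/=; apply/hasPn => j; rewrite mem_iota => /andP[+ _].
  apply: contraL => jr; rewrite -ltnNge ltn_addl//.
  by rewrite (@leq_bigmax_seq _ _ _ succn).
- by rewrite size_cat size_iota subnKC.
- move=> j; rewrite mem_cat mem_iota => /orP[/rs//|/andP[+ _]].
  by apply: leq_trans; rewrite leq_addr.
Qed.

(** Split the coefficients into levels according to their order of magnitude.
    The hypothesis on sums over [n s] indices leaves at most [n s]
    coefficients at level [s] beyond index [s], with sum at most [kappa * 2 ^ s];
    the slow growth of [u] with constant [4 ^ -s] then bounds the contribution of
    the level by a multiple of [2 ^ -s]. *)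
Lemma domination (C : R) (N L : nat -> nat) : 0 <= C ->
  exists (n : nat -> nat) (kappa : R), [/\ forall s, (0 < n s)%N, 0 < kappa &
    forall u : nat -> X, (forall j, `|u j| <= C) ->
    (forall s (r : seq nat) (a : nat -> R) M, uniq r ->
      (forall j, j \in r -> (L s <= j)%N) -> 0 <= M -> (forall j, j \in r -> `|a j| <= M) ->
      `|\sum_(j <- r) a j *: u j|
         <= 4^-1 ^+ s * (\sum_(j <- r) `|a j| + (N s)%:R * M)) ->
    forall (Q : nat) (a : nat -> R),
      (forall s (r : seq nat), uniq r -> size r = n s ->
        (forall j, j \in r -> (s <= j)%N) -> \sum_(j <- r) `|a j| <= kappa * 2 ^+ s) ->
      `|\sum_(j < Q) a j *: u j| <= 1].
Proof.
move=> C0; pose D := level_scale N L.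
have D0 s : (0 < D s)%N by elim: s => [|s IH]//=; rewrite !muln_gt0 IH.
have D2 s : (2 ^ s <= D s)%N.
  elim: s => [|s IH] //=; rewrite expnS -[leqLHS]muln1.
  by rewrite leq_mul// leq_mul2l IH.
have DS s : (D s <= D s.+1)%N by rewrite /= -/(D s); nia.
have DNL s : (2 ^ s * (s + N s + L s) <= D s)%N.
  case: s => [|s]; first by rewrite /= mul1n; lia.
  rewrite [D s.+1]/= -/(D s) expnS leq_mul// ?leq_mul2l ?D2//; lia.
(* So large that [n s] coefficients exceeding the order of magnitude of level [s.+1]
   would sum to more than [k * 2 ^ s]. *)
pose n s := (2 ^ s * D s.+1).+1.
pose B : R := C * (D 0)%:R + 1 + (D 0)%:R.
have B0 : 0 < B by rewrite /B ltr_wpDr// ltr_wpDl// mulr_ge0.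
pose k := (2 * B)^-1; have k0 : 0 < k by rewrite invr_gt0 mulr_gt0.
exists n, k; split=> [s||u uC usum Q a aA] //.
pose del s : R := k * (D 0)%:R / (D s)%:R.
have Dr s : 0 < (D s)%:R :> R by rewrite ltr0n.
have del0 s : 0 < del s by rewrite !mulr_gt0// invr_gt0.
have delS s : del s.+1 <= del s.
  by rewrite ler_wpM2l ?mulr_ge0 ?(ltW k0)// lef_pV2 ?posrE// ler_nat.
have aA' s r : uniq r -> (size r <= n s)%N -> (forall j, j \in r -> (s <= j)%N) ->
    \sum_(j <- r) `|a j| <= k * 2 ^+ s.
  move=> ur rn rs; have [q [uq sq qs]] := enlarge_index_set ur rs rn.
  by apply: le_trans (aA _ _ uq sq qs); rewrite big_cat/= lerDl sumr_ge0.
have ak j : `|a j| <= k.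
  have := @aA' 0%N [:: j]; rewrite big_seq1 expr0 mulr1; apply=> //.
have two s : 2^-1 ^+ s = (2 ^ s)%:R^-1 :> R by rewrite exprVn natrX.
have level s : `|\sum_(j <- iota 0 Q | (del s.+1 < `|a j|) && (`|a j| <= del s)) a j *: u j|
    <= k * B * 2^-1 ^+ s.
  set P := fun j => (del s.+1 < `|a j|) && (`|a j| <= del s).
  rewrite (bigID (fun j => (j < s + L s)%N))/=.
  have h1 : `|\sum_(j <- iota 0 Q | P j && (j < s + L s)%N) a j *: u j|
      <= k * (C * (D 0)%:R) * 2^-1 ^+ s.
    apply: (le_trans (ler_norm_sum _ _ _)).
    apply: (@le_trans _ _ (\sum_(j <- iota 0 Q | (j < s + L s)%N) (del s * C))).
      rewrite big_mkcondl/=; apply: ler_sum => j _.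
      case: ifPn => [/andP[_ h]|_]; last by rewrite mulr_ge0// ltW.
      by rewrite normrZ ler_pM.
    rewrite big_const_seq iter_addr_0 -[_ *+ _]mulr_natr.
    have cnt : (count (fun j => (j < s + L s)%N) (iota 0 Q) <= s + L s)%N.
      rewrite -size_filter -[leqRHS](size_iota 0); apply: uniq_leq_size.
        by rewrite filter_uniq// iota_uniq.
      by move=> j; rewrite mem_filter !mem_iota/= add0n => /andP[].
    apply: (@le_trans _ _ (del s * C * (s + L s)%:R)).
      by rewrite ler_wpM2l ?ler_nat// mulr_ge0// ltW.
    have : (s + L s)%:R <= (D s)%:R * 2^-1 ^+ s :> R.
      rewrite two ler_pdivlMr ?ltr0n ?expn_gt0// -natrM ler_nat mulnC.
      by apply: leq_trans (DNL s); rewrite leq_mul2l; apply/orP; right; lia.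
    move=> h; apply: (@le_trans _ _ (del s * C * ((D s)%:R * 2^-1 ^+ s))).
      by rewrite ler_wpM2l// mulr_ge0// ltW.
    by rewrite /del le_eqVlt; apply/orP; left; apply/eqP; field; rewrite gt_eqF.
  have h2 : `|\sum_(j <- iota 0 Q | P j && ~~ (j < s + L s)%N) a j *: u j|
      <= k * (1 + (D 0)%:R) * 2^-1 ^+ s.
    rewrite -big_filter; set r := [seq j <- _ | _].
    have ur : uniq r by rewrite filter_uniq// iota_uniq.
    have rP j : j \in r -> [/\ del s.+1 < `|a j|, `|a j| <= del s & (s + L s <= j)%N].
      by rewrite mem_filter -leqNgt => /andP[/andP[/andP[? ?] ?] _].
    have rn : (size r <= n s)%N.
      rewrite leqNgt; apply/negP => nr; pose q := take (n s) r.
      have szq : size q = n s by apply: size_takel; exact: ltnW.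
      have qr j : j \in q -> j \in r by apply: mem_take.
      have := aA' s q; rewrite szq leqnn take_uniq// => /(_ isT isT).
      have qs j : j \in q -> (s <= j)%N by move=> /qr/rP[_ _]; lia.
      move=> /(_ qs); apply/negP; rewrite -ltNge.
      apply: (@lt_le_trans _ _ (\sum_(j <- q) del s.+1)); last first.
        by rewrite big_seq [leRHS]big_seq; apply: ler_sum => j /qr/rP[/ltW].
      rewrite big_const_seq count_predT iter_addr_0 szq -(mulr_natl (del s.+1)).
      have -> : (n s)%:R = 2 ^+ s * (D s.+1)%:R + 1 :> R by rewrite /n -natr1 natrM natrX.
      rewrite mulrDl mul1r.
      apply: ltr_pwDr => //; rewrite /del.
      have -> : 2 ^+ s * (D s.+1)%:R * (k * (D 0)%:R / (D s.+1)%:R) = k * 2 ^+ s * (D 0)%:R.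
        by field; rewrite gt_eqF.
      by rewrite ler_peMr ?ler1n// mulr_ge0 ?exprn_ge0// ltW.
    have rL j : j \in r -> (L s <= j)%N by move=> /rP[_ _]; apply: leq_trans; exact: leq_addl.
    have rs j : j \in r -> (s <= j)%N by move=> /rP[_ _]; apply: leq_trans; exact: leq_addr.
    have rd j : j \in r -> `|a j| <= del s by move=> /rP[].
    apply: le_trans (usum s r a (del s) ur rL (ltW (del0 s)) rd) _.
    have h3 : (N s)%:R * del s <= k * (D 0)%:R.
      rewrite /del mulrA ler_pdivrMr// mulrC ler_wpM2l//.
        by rewrite mulr_ge0// ltW.
      by rewrite ler_nat; apply: leq_trans (DNL s); rewrite -[leqLHS]mul1n leq_mul ?expn_gt0//; lia.
    apply: (@le_trans _ _ (4^-1 ^+ s * (k * 2 ^+ s + k * (D 0)%:R * 2 ^+ s))).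
      rewrite ler_wpM2l ?exprn_ge0 ?invr_ge0// lerD ?aA'//.
      apply: (le_trans h3); rewrite ler_peMr ?exprn_ege1 ?ler1n//.
      by rewrite mulr_ge0// ltW.
    have -> : 2^-1 ^+ s = 4^-1 ^+ s * 2 ^+ s :> R.
      by rewrite -exprMn; congr (_ ^+ _); field.
    by rewrite le_eqVlt; apply/orP; left; apply/eqP; ring.
  apply: (le_trans (ler_normD _ _)); apply: (le_trans (lerD h1 h2)).
  by rewrite /B le_eqVlt; apply/orP; left; apply/eqP; ring.
have large S : `|\sum_(j <- iota 0 Q | del S < `|a j|) a j *: u j|
    <= k * B * 2 * (1 - 2^-1 ^+ S).
  elim: S => [|S IH].
    rewrite big1 ?normr0 ?expr0 ?subrr ?mulr0// => j.
    by rewrite /del mulfK ?gt_eqF// ltNge ak.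
  rewrite (bigID (fun j => `|a j| <= del S))/= addrC.
  apply: (le_trans (ler_normD _ _)).
  have -> : \sum_(j <- iota 0 Q | (del S.+1 < `|a j|) && ~~ (`|a j| <= del S)) a j *: u j
      = \sum_(j <- iota 0 Q | del S < `|a j|) a j *: u j.
    apply: eq_bigl => j; rewrite -ltNge andb_idl// => h.
    by apply: le_lt_trans h; exact: delS.
  apply: (le_trans (lerD IH (level S))); rewrite le_eqVlt; apply/orP; left; apply/eqP.
  by rewrite exprS; field.
have kB : k * B * 2 = 1 by rewrite /k -mulrA (mulrC B) mulVf// gt_eqF// mulr_gt0.
apply/ler_addgt0Pl => e e0.
pose z : R := k * (D 0)%:R * C * Q%:R / e.
have z0 : 0 <= z by rewrite /z divr_ge0 ?(ltW e0)// !mulr_ge0 ?(ltW k0)//.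
pose S := Num.bound z.
have zS : z <= (D S)%:R.
  apply: (le_trans (ltW (archi_boundP z0))); rewrite ler_nat.
  by apply: leq_trans (D2 S); apply/ltnW/ltn_expl.
rewrite -(big_mkord xpredT (fun j => a j *: u j)) /index_iota subn0.
rewrite (bigID (fun j => `|a j| <= del S))/=.
apply: (le_trans (ler_normD _ _)); apply: lerD.
  apply: (le_trans (ler_norm_sum _ _ _)).
  apply: (@le_trans _ _ (\sum_(j <- iota 0 Q) (del S * C))).
    rewrite big_mkcond/=; apply: ler_sum => j _; case: ifPn => h.
      by rewrite normrZ ler_pM.
    by rewrite mulr_ge0// ltW.
  rewrite big_const_seq count_predT size_iota iter_addr_0 -[_ *+ _]mulr_natr.
  rewrite /del [leLHS](_ : _ = z * e / (D S)%:R); last by rewrite /z; field; rewrite !gt_eqF.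
  by rewrite ler_pdivrMr// mulrC ler_wpM2l// ltW.
under eq_bigl do rewrite -ltNge.
apply: (le_trans (large S)); rewrite kB mul1r gerBl exprn_ge0// invr_ge0//.
Qed.

End domination.

(** * Weighted sums of blocks *)

(** Injective and above the sum of its arguments: weights [2 ^ -l] over codes [l]
    are therefore bounded by products of weights over the coded indices. *)
Definition npair (c j : nat) : nat := (2 ^ c * j.*2.+1).-1.
Definition npair_fst (l : nat) : nat := logn 2 l.+1.
Definition npair_snd (l : nat) : nat := (l.+1 %/ 2 ^ logn 2 l.+1)./2.

Lemma npairS c j : (npair c j).+1 = (2 ^ c * j.*2.+1)%N.
Proof. by rewrite /npair prednK// muln_gt0 expn_gt0. Qed.

Lemma npairK1 c j : npair_fst (npair c j) = c.
Proof.
rewrite /npair_fst npairS lognM ?expn_gt0// pfactorK// lognE dvdn2/= odd_double/=.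
by rewrite addn0.
Qed.

Lemma npairK2 c j : npair_snd (npair c j) = j.
Proof.
rewrite /npair_snd -/(npair_fst _) npairK1 npairS mulKn ?expn_gt0//.
exact: (half_bit_double j true).
Qed.

Lemma npair_ge c j : (c + j <= npair c j)%N.
Proof.
rewrite -ltnS npairS; apply: (@leq_trans (c.+1 * j.*2.+1)); first nia.
by rewrite leq_mul2r ltn_expl// orbT.
Qed.

Lemma npair_le c c' j j' : (c <= c')%N -> (j <= j')%N -> (npair c j <= npair c' j')%N.
Proof.
by move=> cc jj; rewrite -ltnS !npairS leq_mul ?leq_pexp2l// ltnS leq_double.
Qed.

Section tower.
Context {R : realType} {X Y : normedModType R} (x : nat -> X) (xt : nat -> Y).
Hypotheses (hsm : has_spreading_model x xt) (wx : weakly_null x) (nx : normalized x).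
Hypotheses (nl1 : ~ equiv_l1_basis xt).

(** Only the first [j + 1] blocks enter the [j]-th vector, which keeps it a finite
    combination of [x]; this is why estimates with the [s]-th block hold for
    indices beyond [s]. *)
Definition weighted (lam : nat -> seq R) (pos : nat -> nat -> nat) (j : nat) : X :=
  \sum_(0 <= r < j.+1) 2^-1 ^+ r *: block x (lam r) (pos j r).

Definition admissible (lam : nat -> seq R) (pos : nat -> nat -> nat) :=
  [/\ forall r, injective (pos^~ r), forall j r, (j <= pos j r)%N &
      forall j r, `|block x (lam r) (pos j r)| <= 2].

Lemma weighted_tail lam pos j q : admissible lam pos ->
  `|\sum_(0 <= r < j.+1 | (q <= r)%N) 2^-1 ^+ r *: block x (lam r) (pos j r)|
    <= 4 * 2^-1 ^+ q.
Proof.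
move=> [_ _ b2]; apply: (le_trans (ler_norm_sum _ _ _)).
apply: (@le_trans _ _ (\sum_(0 <= r < j.+1 | (q <= r)%N) 2 * 2^-1 ^+ r)).
  apply: ler_sum => r _; rewrite normrZ ger0_norm ?exprn_ge0 ?invr_ge0//.
  by rewrite mulrC ler_wpM2r ?exprn_ge0 ?invr_ge0.
have [jq|qj] := ltnP j q.
  rewrite big_nat_cond big_pred0 ?mulr_ge0 ?exprn_ge0 ?invr_ge0// => r.
  by apply/negbTE/negP => /andP[]; lia.
rewrite (@big_cat_nat _ _ _ q)//=; last exact: leqW.
rewrite big_nat_cond big_pred0 ?add0r; last first.
  by move=> r; case: (ltnP r q); rewrite ?andbF.
have h : \sum_(q <= r < j.+1 | (q <= r)%N) 2 * 2^-1 ^+ r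
       = 2 * 2^-1 ^+ q + \sum_(q.+1 <= r < j.+1) 2 * 2^-1 ^+ r :> R.
  rewrite big_ltn_cond ?ltnS// leqnn; congr (_ + _).
  rewrite big_nat_cond [RHS]big_nat_cond; apply: eq_bigl => r.
  by case: (ltnP q r) => //= qr; rewrite (ltnW qr) !andbT.
rewrite h; have := @geometric_tail_le R q j.+1 2 (ltr0n _ 2); lra.
Qed.

Lemma weighted_norm lam pos j : admissible lam pos -> `|weighted lam pos j| <= 4.
Proof. by move=> /(weighted_tail j 0); rewrite expr0 mulr1. Qed.

(** The blocks with [r >= q] have total norm [O(2 ^ -q)].  The remaining ones
    involve finitely many coefficients of blocks, fixed in advance, each
    multiplying a sum along [x] to which [sublinear_sums] applies.  The constants
    do not depend on the positions of the blocks: this is what allows the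
    positions to be chosen after all lengths. *)
Lemma weighted_sublinear (lam : nat -> seq R) (e : R) : 0 < e ->
  exists N L : nat, forall pos, admissible lam pos ->
    forall (s : seq nat) (a : nat -> R) (M : R),
    uniq s -> (forall j, j \in s -> (L <= j)%N) ->
    0 <= M -> (forall j, j \in s -> `|a j| <= M) ->
    `|\sum_(j <- s) a j *: weighted lam pos j|
       <= e * (\sum_(j <- s) `|a j| + N%:R * M).
Proof.
move=> e0.
have [q hq] : exists q, 4 * 2^-1 ^+ q <= e / 2 :> R.
  pose z : R := 8 / e; have z0 : 0 <= z by rewrite divr_ge0// ltW.
  exists (Num.bound z).
  have : z <= 2 ^+ Num.bound z.
    apply: (le_trans (ltW (archi_boundP z0))); rewrite -natrX ler_nat.
    by apply/ltnW/ltn_expl.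
  rewrite exprVn ler_pdivrMr ?exprn_gt0// /z ler_pdivrMr//; lra.
pose S : R := \sum_(r < q) \sum_(k < size (lam r)) `|(lam r)`_k|.
have S0 : 0 <= S by do 2![apply: sumr_ge0 => ? _].
have d0 : 0 < e / (2 * (1 + S)) by rewrite divr_gt0// mulr_gt0// ltr_pwDl.
have [N [L hNL]] := sublinear_sums hsm wx nx nl1 d0.
exists N, L => pos adm s a M us sL M0 aM.
have [inj posj b2] := adm.
set G := \sum_(j <- s) `|a j| + N%:R * M.
have G0 : 0 <= G by rewrite addr_ge0 ?sumr_ge0 ?mulr_ge0.
pose head j := \sum_(0 <= r < j.+1 | (r < q)%N) 2^-1 ^+ r *: block x (lam r) (pos j r).
pose tail j := \sum_(0 <= r < j.+1 | (q <= r)%N) 2^-1 ^+ r *: block x (lam r) (pos j r).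
have split_ht j : weighted lam pos j = head j + tail j.
  rewrite /weighted (bigID (fun r => (r < q)%N)) /=; congr (_ + _).
  by apply: eq_bigl => r; rewrite -leqNgt.
under eq_bigr do rewrite split_ht scalerDr.
rewrite big_split/=; apply: (le_trans (ler_normD _ _)).
have ht : `|\sum_(j <- s) a j *: tail j| <= e / 2 * G.
  apply: (le_trans (ler_norm_sum _ _ _)).
  apply: (@le_trans _ _ (\sum_(j <- s) `|a j| * (e / 2))).
    apply: ler_sum => j _; rewrite normrZ ler_wpM2l//.
    by apply: le_trans hq; exact: weighted_tail.
  rewrite -mulr_suml mulrC ler_wpM2l ?divr_ge0 ?(ltW e0)// /G lerDl.
  by rewrite mulr_ge0.
have hh : `|\sum_(j <- s) a j *: head j| <= e / 2 * G.
  have -> : \sum_(j <- s) a j *: head j = \sum_(r < q) \sum_(k < size (lam r))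
      (2^-1 ^+ r * (lam r)`_k) *: \sum_(j <- [seq j <- s | (r <= j)%N]) a j *: x (pos j r + k)%N.
    have -> : \sum_(j <- s) a j *: head j = \sum_(j <- s) \sum_(r < q | (r <= j)%N)
        \sum_(k < size (lam r)) (2^-1 ^+ r * (lam r)`_k) *: (a j *: x (pos j r + k)%N).
      apply: eq_bigr => j _; rewrite /head.
      have -> : \sum_(0 <= r < j.+1 | (r < q)%N) 2^-1 ^+ r *: block x (lam r) (pos j r)
          = \sum_(r < q | (r <= j)%N) 2^-1 ^+ r *: block x (lam r) (pos j r).
        rewrite -(big_mkord (fun r => (r <= j)%N)
          (fun r => 2^-1 ^+ r *: block x (lam r) (pos j r))).
        rewrite [LHS](big_nat_widen _ _ (maxn q j.+1)) ?leq_maxr//.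
        rewrite [RHS](big_nat_widen _ _ (maxn q j.+1)) ?leq_maxl//.
        by apply: eq_bigl => r; rewrite ltnS andbC.
      rewrite scaler_sumr; apply: eq_bigr => r _.
      rewrite /block !scaler_sumr; apply: eq_bigr => k _.
      by rewrite !scalerA; congr (_ *: _); ring.
    rewrite (exchange_big_dep xpredT)//=; apply: eq_bigr => r _.
    rewrite exchange_big/=; apply: eq_bigr => k _.
    by rewrite big_filter scaler_sumr.
  apply: (le_trans (ler_norm_sum _ _ _)).
  apply: (@le_trans _ _ (\sum_(r < q) \sum_(k < size (lam r))
      `|(lam r)`_k| * (e / (2 * (1 + S)) * G))).
    apply: ler_sum => r _; apply: (le_trans (ler_norm_sum _ _ _)).
    apply: ler_sum => k _; rewrite normrZ ler_pM//.
      by rewrite normrM ger0_norm ?exprn_ge0 ?invr_ge0// ler_piMl// half_expn_le1.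
    apply: (le_trans (hNL _ (fun j => pos j r + k)%N a M _ _ M0 _)).
    - rewrite map_inj_uniq ?filter_uniq// => i j /addIn; exact: inj.
    - move=> j; rewrite mem_filter => /andP[_ /sL Lj].
      by rewrite (leq_trans Lj)// (leq_trans (posj j r))// leq_addr.
    - by move=> j; rewrite mem_filter => /andP[_ /aM].
    rewrite ler_wpM2l ?(ltW d0)// /G lerD2r big_filter big_mkcond/=.
    by apply: ler_sum => j _; case: ifP.
  under eq_bigr do rewrite -mulr_suml.
  rewrite -mulr_suml -/S mulrA ler_wpM2r//.
  rewrite [leLHS](_ : _ = e / 2 * (S / (1 + S))); last first.
    by field; rewrite gt_eqF// ltr_pwDl.
  by rewrite ler_piMr ?divr_ge0 ?(ltW e0)// ler_pdivrMr ?ltr_pwDl// mul1r lerDr.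
by apply: (le_trans (lerD hh ht)); rewrite -mulrDl -splitr.
Qed.
End tower.

(** * The tower of sequences *)

Section tower_construction.
Context {R : realType} {X Y : normedModType R} (x : nat -> X) (xt : nat -> Y).
Hypotheses (hsm : has_spreading_model x xt) (wx : weakly_null x) (nx : normalized x).
Hypotheses (nl1 : ~ equiv_l1_basis xt) (hK : Krivine_set xt 1%E).

Lemma weighted_domination (lam : nat -> seq R) :
  exists n : nat -> nat, (forall s, (0 < n s)%N) /\
    exists2 kappa : R, 0 < kappa & forall pos, admissible x lam pos ->
      forall (Q : nat) (a : nat -> R),
      (forall s (r : seq nat), uniq r -> size r = n s ->
        (forall j, j \in r -> (s <= j)%N) -> \sum_(j <- r) `|a j| <= kappa * 2 ^+ s) ->
      `|\sum_(j < Q) a j *: weighted x lam pos j| <= 1.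
Proof.
have e0 s : 0 < 4^-1 ^+ s :> R by rewrite exprn_gt0// invr_gt0.
have /choice[N hN] := fun s => weighted_sublinear hsm wx nx nl1 lam (e0 s).
have /choice[L hL] := hN.
have [n [k [n0 k0 hn]]] := @domination R X 4 N L (ler0n _ 4).
exists n; split=> //; exists k => // pos adm Q a ha; apply: hn => //.
  by move=> j; exact: weighted_norm.
by move=> s r b M; exact: hL.
Qed.

Lemma block_weakly_null (lam : seq R) (F : X -> R) : contractive F ->
  F (block x lam k) @[k --> \oo] --> 0.
Proof.
move=> cF; rewrite /block.
elim: (size lam) => [|n IH].
  under eq_fun do rewrite big_ord0 (functional0 cF.1).
  exact: cvg_cst.
have -> : (fun k => F (\sum_(i < n.+1) lam`_i *: x (k + i)%N)) =
    (fun k => F (\sum_(i < n) lam`_i *: x (k + i)%N) + lam`_n * F (x (k + n)%N)).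
  by apply/funext => k; rewrite big_ord_recr /= addrC cF.1 addrC.
have h1 : F (x (k + n)%N) @[k --> \oo] --> 0.
  apply: (@cvg_comp _ _ _ (addn^~ n) (F \o x) _ \oo); first exact: cvg_addnr.
  exact: contractive_cvg0.
have h2 : (lam`_n * F (x (k + n)%N)) @[k --> \oo] --> lam`_n * 0.
  exact: (cvgM (cvg_cst _) h1).
by have h3 := cvgD IH h2; rewrite mulr0 addr0 in h3; exact: h3.
Qed.

Definition ell1_block (n : nat) (lam : seq R) : Prop :=
  exists L : nat,
    (forall mu, (L <= mu)%N -> `|block x lam mu| <= 2) /\
    forall (s : seq nat) (sg : seq bool), size s = n ->
      sorted (fun i j => i + size lam <= j)%N s -> (forall mu, mu \in s -> (L <= mu)%N) ->
      exists f, contractive f /\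
        forall t, (t < n)%N -> 3 / 4 <= (-1) ^+ nth false sg t * f (block x lam (nth 0%N s t)).

(** Recursion on [i]: the blocks at level [i] determine the lengths [n i.+1], for
    which new blocks are then provided by the Krivine set. *)
Lemma tower_blocks :
  exists (n : nat -> nat -> nat) (lam : nat -> nat -> seq R),
    [/\ forall i r, (0 < n i r)%N, forall i r, ell1_block (n i r) (lam i r) &
      forall i, exists2 kappa : R, 0 < kappa & forall pos, admissible x (lam i) pos ->
      forall (Q : nat) (a : nat -> R),
      (forall s (r : seq nat), uniq r -> size r = n i.+1 s ->
        (forall j, j \in r -> (s <= j)%N) -> \sum_(j <- r) `|a j| <= kappa * 2 ^+ s) ->
      `|\sum_(j < Q) a j *: weighted x (lam i) pos j| <= 1].
Proof.
have /choice[nb hnb] n : exists lam, (0 < n)%N -> ell1_block n lam.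
  have [n0|] := ltnP 0 n; last by exists [::].
  by have [lam hlam] := krivine_block hsm n0 hK; exists lam.
have /choice[ns hns] := weighted_domination.
pose n := fix n i : nat -> nat := if i is i'.+1 then ns (nb \o n i') else fun=> 1%N.
have n0 i r : (0 < n i r)%N by case: i => // i; exact: (hns _).1.
exists n, (fun i => nb \o n i); split=> // [i r|i]; first exact: hnb.
exact: (hns (nb \o n i)).2.
Qed.

(** Places one block at each stage [l], of the family coded in the first component
    of [l], so that every family is used infinitely often.  The functionals to
    decouple are those bounded below, up to prescribed signs, on [n c] blocks of
    family [c]. *)
Lemma ell1_stages (n : nat -> nat) (lam : nat -> seq R) :
  (forall c, ell1_block (n c) (lam c)) ->
  exists m : nat -> nat, let y l := block x (lam (npair_fst l)) (m l) in
    [/\ injective m, forall l, (l <= m l)%N, forall l, `|y l| <= 2 &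
      forall (c J : nat) (b : pred nat) (sg : nat -> bool),
        (forall l, b l -> (l < J)%N /\ npair_fst l = c) -> count b (iota 0 J) = n c ->
        exists g, [/\ forall (a : R) u v, g (a *: u + v) = a * g u + g v,
          forall u, `|g u| <= 2 * `|u|,
          forall l, b l -> 2^-1 <= (-1) ^+ sg l * g (y l) &
          forall l, (l < J)%N -> ~~ b l -> `|g (y l)| <= 64^-1 * 2^-1 ^+ l]].
Proof.
move=> /choice[L hL].
pose T := (nat * seq bool)%type.
pose act l : seq T := [seq (c, s) | c <- iota 0 l.+1,
   s <- [seq val t | t <- enum {: (n c).-tuple bool}]].
have actP l c s : (c <= l)%N -> size s = n c -> (c, s) \in act l.
  move=> cl sn; apply/allpairsPdep; exists c, s; split=> //.
    by rewrite mem_iota add0n ltnS.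
  by move/eqP: sn => sn; apply/mapP; exists (Tuple sn); rewrite ?mem_enum.
have actE l c s : (c, s) \in act l -> (c <= l)%N /\ size s = n c.
  move=> /allpairsPdep[c' [s' [+ /mapP[t _ ->] [-> ->]]]].
  by rewrite mem_iota add0n ltnS size_tuple.
have /choice[f hf] (t : T) : exists f : seq nat -> X -> R, forall s, contractive (f s) /\
    (size s = n t.1 -> sorted (fun i j => i + size (lam t.1) <= j)%N s ->
     (forall mu, mu \in s -> (L t.1 <= mu)%N) ->
     forall k, (k < n t.1)%N ->
       3 / 4 <= (-1) ^+ nth false t.2 k * f s (block x (lam t.1) (nth 0%N s k))).
  suff /choice[f hf] s : exists f : X -> R, contractive f /\
    (size s = n t.1 -> sorted (fun i j => i + size (lam t.1) <= j)%N s ->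
     (forall mu, mu \in s -> (L t.1 <= mu)%N) ->
     forall k, (k < n t.1)%N ->
       3 / 4 <= (-1) ^+ nth false t.2 k * f (block x (lam t.1) (nth 0%N s k))) by exists f.
  have [[s1 s2 s3]|ns] := pselect ([/\ size s = n t.1,
     sorted (fun i j => i + size (lam t.1) <= j)%N s &
     forall mu, mu \in s -> (L t.1 <= mu)%N]).
    by have [f [cf hf]] := (hL t.1).2 s t.2 s1 s2 s3; exists f; split=> // _ _ _.
  exists (fun=> 0); split; last by move=> s1 s2 s3; case: ns.
  by split=> [a u v|u]; rewrite ?mulr0 ?addr0// normr0.
(* Beyond [gap l], all blocks of families up to [l] are good and can be separated. *)
pose gap l := (l + \sum_(c < l.+1) (L c + size (lam c)))%N.
have gapP l c : (c <= l)%N -> (L c + size (lam c) <= gap l)%N.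
  move=> cl; rewrite /gap (bigD1 (Ordinal (cl : (c < l.+1)%N)))//=; lia.
have npair_fst_le l : (npair_fst l <= l)%N.
  rewrite /npair_fst -ltnS; apply: leq_trans (ltn_expl _ (isT : 1 < 2)%N) _.
  by apply: dvdn_leq => //; exact: pfactor_dvdnn.
have d0 : 0 < 192^-1 :> R by rewrite invr_gt0.
have [||||m [mL hm]] := @decoupling R X T act (fun t => n t.1) f
  (fun l k => block x (lam (npair_fst l)) k)
  (fun h => (gap (size h) + \max_(k <- h) k)%N) 192^-1.
- exact: d0.
- move=> l l' ll' [c s] /actE[cl sn]; apply: actP => //; exact: leq_trans ll'.
- by move=> l F; exact: block_weakly_null.
- by move=> t s; have [] := hf t s.
have mgap l : (gap l <= m l)%N.
  by apply: leq_trans (mL l); rewrite size_mkseq leq_addr.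
have msep l l' c : (l < l')%N -> (c <= l')%N -> (m l + size (lam c) <= m l')%N.
  move=> ll' cl'; apply: leq_trans (mL l'); rewrite size_mkseq addnC.
  have := gapP _ _ cl'.
  have : (m l <= \max_(k <- mkseq m l') k)%N.
    by rewrite (@leq_bigmax_seq _ _ _ id)//; apply: map_f; rewrite mem_iota.
  by lia.
have mlt l l' : (l < l')%N -> (m l < m l')%N.
  move=> ll'; apply: leq_trans (mL l'); rewrite size_mkseq.
  have : (m l <= \max_(k <- mkseq m l') k)%N.
    by rewrite (@leq_bigmax_seq _ _ _ id)//; apply: map_f; rewrite mem_iota.
  by rewrite /gap; lia.
have Lm c l : (c <= l)%N -> (L c <= m l)%N.
  by move=> /gapP; have := mgap l; lia.
exists m; split.
- by move=> l l' mm; case: (ltngtP l l') => // /mlt; rewrite mm ltnn.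
- by move=> l; apply: leq_trans (mgap l); rewrite leq_addr.
- by move=> l; apply: (hL _).1; exact: Lm.
move=> c J b sg bP cb.
pose r := [seq l <- iota 0 J | b l].
pose s := [seq m l | l <- r].
have szr : size r = n c by rewrite size_filter.
have rb l : l \in r -> b l by rewrite mem_filter => /andP[].
have br l : b l -> l \in r.
  by move=> bl; rewrite mem_filter bl mem_iota/= add0n; have [] := bP l bl.
have cl l : b l -> (c <= l)%N by move=> /bP[_ <-].
have [||g [glin gle gsel gun]] := hm (c, [seq sg l | l <- r]) b J.
- by rewrite size_map szr.
- by move=> l bl; apply: actP; [exact: cl | rewrite size_map szr].
have h192 : 3 * 192^-1 = 64^-1 :> R by field.
rewrite h192 in gsel gun.
exists g; split=> // l bl.
have [lJ cfl] := bP l bl.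
have lr := br l bl.
have kn : (index l r < n c)%N by rewrite -szr index_mem.
have [cf] := hf (c, [seq sg l | l <- r]) s.
have ss : sorted (fun i j => i + size (lam c) <= j)%N s.
  rewrite sorted_map; have := iota_ltn_sorted 0 J => /(sorted_filter ltn_trans b).
  rewrite -/r; apply: (@sub_in_sorted _ b); last by apply/allP => i /rb.
  by move=> i j bi bj ij /=; apply: msep => //; exact: cl.
have sL mu : mu \in s -> (L c <= mu)%N by move=> /mapP[l' /rb/cl/Lm lm ->].
move=> /(_ _ ss sL _ kn); rewrite size_map szr => /(_ erefl).
rewrite /= (nth_map 0%N) ?szr// (nth_map 0%N) ?szr// nth_index// => h.
have := gsel l lJ bl; rewrite /= cfl => h2.
have h3 : `|(-1) ^+ sg l * g (block x (lam c) (m l)) - (-1) ^+ sg l *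
   f (c, [seq sg l | l <- r]) s (block x (lam c) (m l))| <= 64^-1.
  rewrite -mulrBr normrM normrX normrN normr1 expr1n mul1r; apply: (le_trans h2).
  by rewrite ler_piMr// half_expn_le1.
have /ler_normlP[h4 _] := h3.
by move: h h4; lra.
Qed.

End tower_construction.

Section estimates.
Context {R : realType} {X Y : normedModType R} (x : nat -> X) (xt : nat -> Y).
Hypotheses (hsm : has_spreading_model x xt) (wx : weakly_null x) (nx : normalized x).
Hypotheses (nl1 : ~ equiv_l1_basis xt) (hK : Krivine_set xt 1%E).

(** Family [npair i r] carries the [r]-th blocks of the sequence [z i].  The
    estimate [key] tests a combination against the functional attached to the
    [s]-th blocks of [n i s] vectors of [z i], with the signs of the coefficients;
    all other blocks contribute at most a small multiple of the largest
    coefficient [M].  Used first where [M] is attained it bounds [M], and then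
    the sums of coefficients required by domination. *)
Lemma dominating_tower : exists z : nat -> nat -> X,
  [/\ forall i j, `|z i j| <= 4,
    forall Q (a : nat -> nat -> R) i j, (i < Q)%N -> (j < Q)%N ->
      `|a i j| <= 16 * `|\sum_(i < Q) \sum_(j < Q) a i j *: z i j| &
    forall i, exists2 K : R, 0 < K & forall Q (a : nat -> nat -> R), (i.+1 < Q)%N ->
      `|\sum_(j < Q) a i.+1 j *: z i j| <=
        K * `|\sum_(i < Q) \sum_(j < Q) a i j *: z i j|].
Proof.
have [n [lam [n0 nlam dom]]] := tower_blocks hsm wx nx nl1 hK.
have [|m [minj mge mnorm hm]] := @ell1_stages R X x wx
   (fun c => n (npair_fst c) (npair_snd c)) (fun c => lam (npair_fst c) (npair_snd c)).
  by move=> c; exact: nlam.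

pose ell i j r := npair (npair i r) j.
pose pos i j r := m (ell i j r).
pose y l := block x (lam (npair_fst (npair_fst l)) (npair_snd (npair_fst l))) (m l).
have yell i j r : y (ell i j r) = block x (lam i r) (pos i j r).
  by rewrite /y /pos npairK1 npairK1 npairK2.
have ellge i j r : (i + j + r <= ell i j r)%N.
  by have := npair_ge i r; have := npair_ge (npair i r) j; rewrite /ell; lia.
have ell_inj i j r i' j' r' : ell i j r = ell i' j' r' -> [/\ i = i', j = j' & r = r'].
  move=> e; have := congr1 npair_fst e; have := congr1 npair_snd e.
  rewrite !npairK1 !npairK2 => -> e2; have := congr1 npair_fst e2.
  by have := congr1 npair_snd e2; rewrite !npairK1 !npairK2.
have adm i : admissible x (lam i) (pos i).
  split=> [r j j' /minj/ell_inj[]//|j r|j r].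
    by have := ellge i j r; have := mge (ell i j r); rewrite /pos; lia.
  by rewrite -yell; exact: mnorm.
pose z i j := weighted x (lam i) (pos i) j.
have zE i j : z i j = \sum_(0 <= r < j.+1) 2^-1 ^+ r *: y (ell i j r).
  by apply: eq_bigr => r _; rewrite yell.
have key Q (a : nat -> nat -> R) (M : R) i s (A : seq nat) :
    (forall i j, (i < Q)%N -> (j < Q)%N -> `|a i j| <= M) -> 0 <= M -> (i < Q)%N ->
    uniq A -> size A = n i s -> (forall j, j \in A -> (s <= j)%N) ->
    2^-1 ^+ s * \sum_(j < Q | val j \in A) `|a i j| <=
      4 * `|\sum_(i < Q) \sum_(j < Q) a i j *: z i j| + M / 4.
  move=> aM M0 iQ uA szA sA.
  (* All stages involved, selected or not, come before [J]. *)
  pose K := (Q + \max_(j <- A) j + s)%N; pose J := (ell K K K).+1.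
  pose b : pred nat := [pred l | l \in [seq ell i j s | j <- A]].
  pose sg l := a i (npair_snd l) < 0.
  have uB : uniq [seq ell i j s | j <- A].
    by rewrite map_inj_uniq// => j j' /ell_inj[].
  have ellJ i' j' r' : (i' <= K)%N -> (j' <= K)%N -> (r' <= K)%N -> (ell i' j' r' < J)%N.
    by move=> h1 h2 h3; rewrite ltnS; do 2!apply: npair_le => //.
  have AK j : j \in A -> (j <= K)%N.
    move=> jA; have : (j <= \max_(j <- A) j)%N by rewrite (@leq_bigmax_seq _ _ _ id).
    by rewrite /K; lia.
  have [||g [glin gle gsel gun]] := hm (npair i s) J b sg.
  - move=> l /mapP[j jA ->]; rewrite npairK1; split=> //; apply: ellJ; last by rewrite /K; lia.
      by rewrite /K; lia.
    exact: AK.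
  - rewrite npairK1 npairK2 -szA -size_filter -(size_map (fun j => ell i j s) A).
    apply/perm_size/uniq_perm => //; first by rewrite filter_uniq// iota_uniq.
    move=> l; rewrite mem_filter mem_iota add0n /= andb_idr// => /mapP[j jA ->].
    by apply: ellJ; [rewrite /K; lia | exact: AK | rewrite /K; lia].
  rewrite -/(y _) in gsel gun.
  set w := \sum_(i < Q) _.
  have gw : g w = \sum_(i' < Q) \sum_(j' < Q) \sum_(0 <= r < j'.+1)
      a i' j' * (2^-1 ^+ r * g (y (ell i' j' r))).
    rewrite /w functional_sum1//; apply: eq_bigr => i' _.
    rewrite (functional_sum glin); apply: eq_bigr => j' _.
    by rewrite zE (functional_sum glin) mulr_sumr.
  pose E i' j' r : R := M / 64 * (2^-1 ^+ i' * (2^-1 ^+ j' * 2^-1 ^+ r)).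
  pose S i' j' r : R :=
    if [&& i' == i, j' \in A & r == s] then 2^-1 ^+ s * `|a i j'| / 2 else 0.
  have h0 k : 0 <= 2^-1 ^+ k :> R by rewrite exprn_ge0// invr_ge0.
  have S0 i' j' r : 0 <= S i' j' r by rewrite /S; case: ifP => // _; rewrite !mulr_ge0.
  have E0 i' j' r : 0 <= E i' j' r by rewrite /E !mulr_ge0.
  have term i' j' r : (i' < Q)%N -> (j' < Q)%N -> (r <= j')%N ->
      S i' j' r - E i' j' r <= a i' j' * (2^-1 ^+ r * g (y (ell i' j' r))).
    move=> i'Q j'Q rj'; have bE : b (ell i' j' r) = [&& i' == i, j' \in A & r == s].
      apply/mapP/and3P => [[j jA /ell_inj[-> -> ->]]|[/eqP-> jA /eqP->]]; first by rewrite !eqxx.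
      by exists j'.
    rewrite /S -bE; case: ifPn => bl.
      have := bl; rewrite bE => /and3P[/eqP ii j'A /eqP rs].
      have := gsel _ bl; rewrite -/(y _) /sg {1}/ell npairK2 ii rs => h.
      apply: (@le_trans _ _ (2^-1 ^+ s * `|a i j'| / 2)); first by rewrite gerBl.
      rewrite -[X in _ <= X * _](mulr_sign_norm (a i j')).
      rewrite [leRHS](_ : _ = 2^-1 ^+ s * `|a i j'| *
        ((-1) ^+ (a i j' < 0)%R * g (y (ell i j' s)))); last by ring.
      by rewrite ler_wpM2l// mulr_ge0.
    rewrite sub0r -[leRHS]opprK lerN2; apply: (le_trans (ler_norm _)).
    rewrite normrN !normrM (ger0_norm (h0 r)) /E.
    have lJ : (ell i' j' r < J)%N by apply: ellJ; rewrite /K; lia.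
    have := gun _ lJ bl; rewrite -/(y _) => h.
    have h1 : `|g (y (ell i' j' r))| <= 64^-1 * (2^-1 ^+ i' * (2^-1 ^+ j' * 2^-1 ^+ r)).
      apply: (le_trans h); rewrite ler_wpM2l// -!exprD.
      have := ellge i' j' r; rewrite -addnA => /subnKC <-.
      by rewrite exprD ler_piMr// half_expn_le1.
    have h2 : 2^-1 ^+ r * `|g (y (ell i' j' r))| <= `|g (y (ell i' j' r))|.
      by rewrite ler_piMl// half_expn_le1.
    rewrite -mulrA; apply: ler_pM => //; first exact: aM.
    exact: le_trans h2 h1.
  have lower : 2^-1 ^+ s / 2 * \sum_(j < Q | val j \in A) `|a i j| <=
      \sum_(i' < Q) \sum_(j' < Q) \sum_(0 <= r < j'.+1) S i' j' r.
    apply: (@le_trans _ _ (\sum_(j' < Q) \sum_(0 <= r < j'.+1) S i j' r)); last first.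
      rewrite [leRHS](bigD1 (Ordinal iQ))//= lerDl.
      by do 2![apply: sumr_ge0 => ? _]; apply: sumr_ge0.
    rewrite mulr_sumr big_mkcond/=; apply: ler_sum => j' _.
    case: ifPn => j'A; last by apply: sumr_ge0.
    rewrite (bigD1_seq s) ?iota_uniq//=; last by rewrite mem_index_iota ltnS sA.
    rewrite {1}/S !eqxx j'A/= mulrAC lerDl; exact: sumr_ge0.
  have upper : \sum_(i' < Q) \sum_(j' < Q) \sum_(0 <= r < j'.+1) E i' j' r <= M / 8.
    apply: (@le_trans _ _ (\sum_(i' < Q) \sum_(j' < Q) M / 64 * (2^-1 ^+ i' * (2^-1 ^+ j' * 2)))).
      apply: ler_sum => i' _; apply: ler_sum => j' _; rewrite /E -!mulr_sumr.
      rewrite ler_wpM2l ?mulr_ge0// ler_wpM2l// ler_wpM2l// big_mkord.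
      exact: sum_half_le2.
    apply: (@le_trans _ _ (\sum_(i' < Q) M / 64 * (2^-1 ^+ i' * (2 * 2)))).
      apply: ler_sum => i' _; rewrite -!mulr_sumr -mulr_suml.
      by rewrite ler_wpM2l ?mulr_ge0// ler_wpM2l// ler_wpM2r// sum_half_le2.
    rewrite -mulr_sumr -mulr_suml [leRHS](_ : _ = M / 64 * (2 * (2 * 2))); last by field.
    by rewrite ler_wpM2l ?mulr_ge0// ler_wpM2r// sum_half_le2.
  have gwle : g w <= 2 * `|w| by apply: le_trans (ler_norm _) (gle w).
  have : \sum_(i' < Q) \sum_(j' < Q) \sum_(0 <= r < j'.+1) S i' j' r -
      \sum_(i' < Q) \sum_(j' < Q) \sum_(0 <= r < j'.+1) E i' j' r <= g w.
    rewrite gw -sumrB; apply: ler_sum => i' _; rewrite -sumrB; apply: ler_sum => j' _.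
    rewrite -sumrB big_nat [leRHS]big_nat; apply: ler_sum => r /andP[_ rj].
    by apply: term.
  by move: lower upper gwle; lra.
have coord Q (a : nat -> nat -> R) i j : (i < Q)%N -> (j < Q)%N ->
    `|a i j| <= 16 * `|\sum_(i < Q) \sum_(j < Q) a i j *: z i j|.
  move=> iQ jQ; set w := \sum_(i < Q) _.
  pose p0 : 'I_Q * 'I_Q := (Ordinal iQ, Ordinal jQ).
  case: (@Order.TotalTheory.arg_maxP _ _ _ p0 xpredT (fun p => `|a p.1 p.2|) isT).
  move=> -[i1 j1] _ /= h.
  have aM i' j' : (i' < Q)%N -> (j' < Q)%N -> `|a i' j'| <= `|a i1 j1|.
    by move=> i'Q j'Q; exact: (h (Ordinal i'Q, Ordinal j'Q) isT).
  apply: (le_trans (h p0 isT)).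
  have [q [uA szA _]] :=
    @enlarge_index_set 0 (n i1 0%N) [:: val j1] isT (fun _ _ => isT) (n0 _ _).
  have := key Q a _ i1 0%N _ aM (normr_ge0 _) (ltn_ord _) uA szA (fun _ _ => isT).
  rewrite expr0 mul1r -/w (bigD1 j1)/= ?mem_head// => h1.
  have h2 : 0 <= \sum_(j < Q | (nat_of_ord j \in nat_of_ord j1 :: q) && (j != j1)) `|a i1 j|.
    exact: sumr_ge0.
  have L (t u v : R) : t + u <= 4 * v + t / 4 -> 0 <= u -> 0 <= v -> t <= 16 * v by lra.
  exact: L h1 h2 (normr_ge0 w).
exists z; split=> // [i j|i]; first exact: weighted_norm.
have [k k0 hk] := dom i; exists (24 / k); first by rewrite divr_gt0.
move=> Q a iQ; set w := \sum_(i < Q) _.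
have [w0|w0] := eqVneq w 0.
  rewrite w0 normr0 mulr0 big1 ?normr0// => j _.
  have := coord Q a i.+1 j iQ (ltn_ord j); rewrite -/w w0 normr0 mulr0 normr_le0.
  by move=> /eqP->; rewrite scale0r.
have nw0 : 0 < `|w| by rewrite normr_gt0.
pose c := k / (24 * `|w|); have c0 : 0 < c by rewrite divr_gt0// mulr_gt0.
pose a' j := if (j < Q)%N then c * a i.+1 j else 0.
have := hk (pos i) (adm i) Q a' _.
have -> : \sum_(j < Q) a' j *: weighted x (lam i) (pos i) j =
    c *: \sum_(j < Q) a i.+1 j *: z i j.
  by rewrite scaler_sumr; apply: eq_bigr => j _; rewrite /a' ltn_ord scalerA.
rewrite normrZ gtr0_norm// -ler_pdivlMl// mulr1 => h; apply: (le_trans (h _)).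
  move=> s r ur szr rs.
  have -> : \sum_(j <- r) `|a' j| = c * \sum_(j < Q | val j \in r) `|a i.+1 j|.
    rewrite mulr_sumr -(big_mkord (fun j => j \in r) (fun j => c * `|a i.+1 j|)).
    rewrite /index_iota subn0 -big_filter.
    rewrite (bigID (fun j => (j < Q)%N))/= [X in _ + X]big1 ?addr0; last first.
      by move=> j jQ; rewrite /a' (negbTE jQ) normr0.
    rewrite -big_filter (perm_big [seq j <- iota 0 Q | j \in r])/=; last first.
      apply: uniq_perm; rewrite ?filter_uniq ?iota_uniq// => j.
      by rewrite !mem_filter mem_iota add0n/= andbC.
    rewrite big_seq [RHS]big_seq; apply: eq_bigr => j; rewrite mem_filter mem_iota add0n.
    by move=> /andP[_ /andP[_ jQ]]; rewrite /a' jQ normrM (gtr0_norm c0).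
  have aM i' j' : (i' < Q)%N -> (j' < Q)%N -> `|a i' j'| <= 16 * `|w|.
    by move=> i'Q j'Q; exact: coord.
  have := key Q a (16 * `|w|) i.+1 s r aM _ iQ ur szr rs.
  rewrite -/w => /(_ (mulr_ge0 (ler0n _ 16) (normr_ge0 w))) h1.
  have p0 : 0 < 2 ^+ s :> R by rewrite exprn_gt0.
  rewrite exprVn ler_pdivrMl// in h1.
  have : c * (2 ^+ s * (4 * `|w| + 16 * `|w| / 4)) = k * 2 ^+ s / 3.
    by rewrite /c; field; rewrite gt_eqF.
  have := mulr_gt0 k0 p0; have := ler_wpM2l (ltW c0) h1.
  by move: (c * _) (c * _) (k * _) => t u v; lra.
by rewrite /c invf_div mulrAC.
Qed.
End estimates.

(** * Operators given by a bounded graph *)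

Section bounded_graph.
Context {R : realType} {X : completeNormedModType R}.

Lemma closure_normP (A : set X) w :
  closure A w <-> forall e : R, 0 < e -> exists2 a, A a & `|w - a| < e.
Proof.
split=> [clA e e0|h B /nbhs_normP[e /= e0 eB]].
  have [|a [Aa wa]] := clA (ball w e); first exact: nbhsx_ballx.
  by exists a => //; move: wa; rewrite -ball_normE.
by have [a Aa wa] := h e e0; exists a; split=> //; exact: eB.
Qed.

(** The closure [H] of [G] is the graph of an operator on the closure of the domain:
    single-valued since bounded, everywhere defined by completeness. *)
Lemma bounded_graph_operator (G : X -> X -> Prop) (C : R) :
  let W := closure [set w | exists v, G w v] in
  G 0 0 -> (forall (a : R) w v w' v', G w v -> G w' v' -> G (a *: w + w') (a *: v + v')) ->
  (forall w v, G w v -> `|v| <= C * `|w|) -> (forall w v, G w v -> W v) ->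
  exists T : X -> X, [/\ closed_subspace W, continuous_operator_on W T &
    forall w v, G w v -> T w = v].
Proof.
move=> W G0 Glin Gbd GW.
have CP : exists2 C' : R, 0 < C' & forall w v, G w v -> `|v| <= C' * `|w|.
  exists (`|C| + 1); first by rewrite ltr_wpDl.
  move=> w v /Gbd/le_trans; apply; rewrite ler_wpM2r//.
  by rewrite (le_trans (ler_norm _))// lerDl.
have {C Gbd CP} [C C0 Gbd] := CP.
have GB w v w' v' : G w v -> G w' v' -> G (w - w') (v - v').
  by move=> h h'; rewrite addrC [v - _]addrC -(scaleN1r w') -(scaleN1r v'); exact: Glin.
pose H w v := forall e : R, 0 < e -> exists w' v', [/\ G w' v', `|w - w'| < e & `|v - v'| < e].
have GH w v : G w v -> H w v.
  by move=> Gwv e e0; exists w, v; rewrite !subrr normr0.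
have Hlin (a : R) w v w' v' : H w v -> H w' v' -> H (a *: w + w') (a *: v + v').
  move=> h h' e e0; pose d := e / (`|a| + 1).
  have a1 : 0 < `|a| + 1 by rewrite ltr_wpDl.
  have d0 : 0 < d by rewrite divr_gt0.
  have [w1 [v1 [G1 hw1 hv1]]] := h d d0; have [w2 [v2 [G2 hw2 hv2]]] := h' d d0.
  have small (y y' y1 y2 : X) : `|y - y1| < d -> `|y' - y2| < d ->
      `|a *: y + y' - (a *: y1 + y2)| < e.
    move=> h1 h2; rewrite opprD addrACA -scalerBr.
    apply: le_lt_trans (ler_normD _ _) _; rewrite normrZ.
    have -> : e = `|a| * d + d by rewrite /d; field; rewrite gt_eqF.
    by apply: ler_ltD => //; rewrite ler_wpM2l// ltW.
  by exists (a *: w1 + w2), (a *: v1 + v2); split; [exact: Glin | exact: small | exact: small].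
have Hbd w v : H w v -> `|v| <= C * `|w|.
  move=> h; apply/ler_addgt0Pl => e e0; pose d := e / (C + 1).
  have d0 : 0 < d by rewrite divr_gt0// addr_gt0.
  have [w1 [v1 [/Gbd G1 hw1 hv1]]] := h d d0.
  have -> : e = d + C * d by rewrite /d; field; rewrite gt_eqF// addr_gt0.
  have h1 : `|v| <= `|v - v1| + `|v1| by rewrite -{1}(subrK v1 v) ler_normD.
  have h2 : `|w1| <= `|w - w1| + `|w| by have := ler_normB w (w - w1); rewrite subKr addrC.
  have h3 : C * `|w1| <= C * (d + `|w|).
    by rewrite ler_wpM2l ?(ltW C0)//; move: h2 hw1; lra.
  by move: h1 h3 hv1 G1; rewrite mulrDr; lra.
have Huniq w v v' : H w v -> H w v' -> v = v'.
  move=> h h'; have := Hbd _ _ (Hlin (-1) _ _ _ _ h h').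
  by rewrite !scaleN1r addNr normr0 mulr0 normr_le0 addrC subr_eq0 => /eqP.
have Htot w : W w -> exists v, H w v.
  move=> /closure_normP Ww.
  have /choice[s hs] n : exists q : X * X, G q.1 q.2 /\ `|w - q.1| < n.+1%:R^-1.
    by have [|w' [v' Gv'] h] := Ww n.+1%:R^-1; [rewrite invr_gt0 | exists (w', v')].
  have near0 (e : R) : 0 < e -> exists n : nat, forall k, (n <= k)%N -> k.+1%:R^-1 < e.
    move=> e0; exists (Num.bound e^-1) => k nk; rewrite invf_plt ?posrE//.
    apply: lt_le_trans (archi_boundP _) _; first by rewrite invr_ge0 ltW.
    by rewrite ler_nat (leq_trans nk).
  have cs : cauchy ((fun n => (s n).2) @ \oo).
    apply: cauchy_exP => e /= e0.
    have [n hn] := near0 (e / (2 * C)) (divr_gt0 e0 (mulr_gt0 (ltr0n _ 2) C0)).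
    exists (s n).2; exists n => // k /= nk; rewrite -ball_normE/=.
    have := Gbd _ _ (GB _ _ _ _ (hs n).1 (hs k).1) => h.
    apply: le_lt_trans h _; rewrite -ltr_pdivlMl//.
    have -> : (s n).1 - (s k).1 = (w - (s k).1) - (w - (s n).1) by rewrite opprB [RHS]addrC subrKA.
    apply: le_lt_trans (ler_normB _ _) _.
    have := lt_trans (hs n).2 (hn n (leqnn _)); have := lt_trans (hs k).2 (hn k nk).
    rewrite (_ : C^-1 * e = e / (2 * C) + e / (2 * C)); first by lra.
    by field; rewrite gt_eqF.
  have : cvg ((fun n => (s n).2) @ \oo) by exact: cauchy_cvg.
  move=> /cvg_ex[v /= hv].
  exists v => e e0; have [n hn] := near0 e e0.
  have /cvgrPdist_lt/(_ e e0)[n' _ hn'] := hv.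
  exists (s (maxn n n')).1, (s (maxn n n')).2; split; first exact: (hs _).1.
    exact: lt_trans (hs _).2 (hn _ (leq_maxl _ _)).
  exact: hn' (leq_maxr _ _).
have HW w v : H w v -> W w.
  by move=> h; apply/closure_normP => e /h[w' [v' [Gw ? _]]]; exists w' => //; exists v'.
have HWv w v : H w v -> W v.
  move=> h; apply/closure_normP => e e0.
  have [w' [v' [/GW/closure_normP h1 _ h2]]] := h (e / 2) (divr_gt0 e0 (ltr0n _ 2)).
  have [b Gb hb] := h1 (e / 2) (divr_gt0 e0 (ltr0n _ 2)); exists b => //.
  by rewrite -(subrKA v') (splitr e); apply: le_lt_trans (ler_normD _ _) _; exact: ltrD.
pose T w := xget 0 [set v | H w v].
have TP w : W w -> H w (T w) by move=> /Htot[v hv]; exact: (xgetPex 0 (ex_intro _ v hv)).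
have TE w v : H w v -> T w = v by move=> h; exact: (Huniq w _ _ (TP _ (HW _ _ h)) h).
have Tlin (a : R) u v : W u -> W v -> T (a *: u + v) = a *: T u + T v.
  by move=> /TP hu /TP hv; apply: TE; exact: Hlin.
have Wlin (a : R) u v : W u -> W v -> W (a *: u + v).
  by move=> /TP hu /TP hv; apply: HW; exact: (Hlin a _ _ _ _ hu hv).
exists T; split.
- split; [exact: HW (GH _ _ G0) | exact: Wlin | exact: closed_closure].
- split=> //; first by move=> w /TP/HWv.
  apply/subspace_continuousP => w Ww; apply/cvgrPdist_lt => e e0.
  rewrite near_withinE; near=> u => Wu.
  have -> : T w - T u = T (-1 *: u + w) by rewrite Tlin// scaleN1r addrC.
  apply: le_lt_trans (Hbd _ _ (TP _ (Wlin _ _ _ Wu Ww))) _.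
  rewrite -ltr_pdivlMl// scaleN1r addrC; near: u.
  by apply: cvgr_dist_lt; [exact: cvg_id | rewrite mulr_gt0// invr_gt0].
- by move=> w v /GH; exact: TE.
Unshelve. all: by end_near. Qed.

Lemma precompact_not_separated (A : set X) (u : nat -> X) (e : R) :
  precompact A -> 0 < e -> (forall j, A (u j)) ->
  exists j l, j != l /\ `|u j - u l| < e.
Proof.
rewrite precompactE => cA e0 Au.
have [|p [_ cp]] := cA (u @ \oo) _.
  by exists 0%N => // n _ /=; apply: subset_closure; exact: Au.
have e2 : 0 < e / 2 by rewrite divr_gt0.
(* Two different terms within [e / 2] of the same cluster point. *)
have [|_ [[j _ <-] hj]] := cp (u @` [set: nat]) (ball p (e / 2)) _ (nbhsx_ballx _ _ e2).
  by exists 0%N => // n _; exists n.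
have [|_ [[l jl <-] hl]] := cp (u @` [set l | (j < l)%N]) (ball p (e / 2)) _ (nbhsx_ballx _ _ e2).
  by exists j.+1 => // n jn; exists n.
exists j, l; split; first by rewrite ltn_eqF.
move: hj hl; rewrite -ball_normE /= => hj hl.
rewrite -(subrKA p) (splitr e); apply: le_lt_trans (ler_normD _ _) _.
by rewrite ltrD// distrC.
Qed.

End bounded_graph.

(** * The weighted shift *)

Section shift.
Context {R : realType} {X : completeNormedModType R} (z : nat -> nat -> X).
Implicit Types (a : nat -> nat -> R) (Q : nat).

Definition comb Q a : X := \sum_(i < Q) \sum_(j < Q) a i j *: z i j.

(** Finitely supported coefficients, for which [comb Q a] does not change when
    [Q] increases. *)
Definition supported Q a := forall i j, (Q <= i)%N || (Q <= j)%N -> a i j = 0.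

Lemma comb_widen Q Q' a : (Q <= Q')%N -> supported Q a -> comb Q' a = comb Q a.
Proof.
move=> QQ sa.
have inner i : \sum_(j < Q') a i j *: z i j = \sum_(j < Q) a i j *: z i j.
  rewrite (big_ord_widen Q' (fun j => a i j *: z i j) QQ) [RHS]big_mkcond/=.
  by apply: eq_bigr => j _; case: ltnP => // Qj; rewrite sa ?Qj ?orbT// scale0r.
rewrite /comb (eq_bigr _ (fun (i : 'I_Q') _ => inner i)).
rewrite (big_ord_widen Q' (fun i => \sum_(j < Q) a i j *: z i j) QQ) [RHS]big_mkcond/=.
apply: eq_bigr => i _; case: ltnP => // Qi.
by rewrite big1// => j _; rewrite sa ?Qi// scale0r.
Qed.

Lemma supported_widen Q Q' a : (Q <= Q')%N -> supported Q a -> supported Q' a.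
Proof. by move=> QQ sa i j h; apply: sa; case/orP: h => h; rewrite (leq_trans QQ h) ?orbT. Qed.

Lemma comb_linear Q (c : R) a b :
  comb Q (fun i j => c * a i j + b i j) = c *: comb Q a + comb Q b.
Proof.
rewrite /comb scaler_sumr -big_split; apply: eq_bigr => i _ /=.
rewrite scaler_sumr -big_split; apply: eq_bigr => j _ /=.
by rewrite scalerDl scalerA.
Qed.

Variable tau : nat -> R.

Definition shift_coef a : nat -> nat -> R := fun i j => tau i * a i.+1 j.

Definition shift_graph (w v : X) :=
  exists Q a, [/\ supported Q a, w = comb Q a & v = comb Q (shift_coef a)].

Lemma supported_shift Q a : supported Q a -> supported Q (shift_coef a).
Proof.
move=> sa i j h; rewrite /shift_coef sa ?mulr0//; case/orP: h => h; rewrite ?h ?orbT//.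
by rewrite leqW.
Qed.

Lemma shift_graph_linear (c : R) w v w' v' : shift_graph w v -> shift_graph w' v' ->
  shift_graph (c *: w + w') (c *: v + v').
Proof.
move=> [Q [a [sa -> ->]]] [Q' [a' [sa' -> ->]]].
exists (maxn Q Q'), (fun i j => c * a i j + a' i j).
have sa1 := supported_widen (leq_maxl Q Q') sa.
have sa1' := supported_widen (leq_maxr Q Q') sa'.
split.
- by move=> i j h; rewrite sa1// sa1'// mulr0 addr0.
- by rewrite comb_linear (comb_widen (leq_maxl Q Q') sa) (comb_widen (leq_maxr Q Q') sa').
- rewrite -(comb_widen (leq_maxl Q Q') (supported_shift sa)).
  rewrite -(comb_widen (leq_maxr Q Q') (supported_shift sa')) -comb_linear.
  by congr comb; apply/funext => i; apply/funext => j; rewrite /shift_coef; ring.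
Qed.

Definition unit_coef i0 j0 (c : R) : nat -> nat -> R :=
  fun i j => if (i == i0) && (j == j0) then c else 0.

Lemma comb_unit Q i j c : (i < Q)%N -> (j < Q)%N -> comb Q (unit_coef i j c) = c *: z i j.
Proof.
move=> iQ jQ; rewrite /comb (bigD1 (Ordinal iQ))//= (bigD1 (Ordinal jQ))//=.
rewrite {1}/unit_coef !eqxx/= !big1 ?addr0// => k.
  move=> ki; apply: big1 => l _; rewrite /unit_coef -val_eqE/= in ki *.
  by rewrite (negbTE ki) scale0r.
by move=> kj; rewrite /unit_coef -val_eqE/= in kj *; rewrite (negbTE kj) andbF scale0r.
Qed.

Lemma unit_supported Q i j c : (i < Q)%N -> (j < Q)%N -> supported Q (unit_coef i j c).
Proof.
move=> iQ jQ k l; rewrite /unit_coef; case: eqP => // ->; case: eqP => // ->.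
by rewrite (leqNgt Q i) iQ (leqNgt Q j) jQ.
Qed.

Lemma shift_graph_basis i j : shift_graph (z i.+1 j) (tau i *: z i j).
Proof.
pose Q := (i + j).+2.
have iQ : (i.+1 < Q)%N by rewrite /Q; lia.
have jQ : (j < Q)%N by rewrite /Q; lia.
exists Q, (unit_coef i.+1 j 1); split; first exact: unit_supported.
  by rewrite comb_unit// scale1r.
rewrite -(comb_unit _ (ltnW iQ) jQ); congr comb.
apply/funext => k; apply/funext => l; rewrite /shift_coef /unit_coef eqSS.
by case: eqP => [->|_]; case: eqP => _ /=; rewrite ?mulr1 ?mulr0.
Qed.

(** Domination of [z i] by [z i.+1] with constant [K i], absorbed by the weights
    [tau i], whose products with [K i] have sum at most 2. *)
Lemma shift_graph_bounded (K : nat -> R) : (forall i, 0 < K i) ->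
  (forall i Q a, (i.+1 < Q)%N -> `|\sum_(j < Q) a i.+1 j *: z i j| <= K i * `|comb Q a|) ->
  (forall i, tau i = 2^-1 ^+ i / K i) ->
  forall w v, shift_graph w v -> `|v| <= 2 * `|w|.
Proof.
move=> K0 hK tauE w v [Q [a [sa -> ->]]].
apply: (le_trans (ler_norm_sum _ _ _)).
apply: (@le_trans _ _ (\sum_(i < Q) 2^-1 ^+ i * `|comb Q a|)); last first.
  by rewrite -mulr_suml ler_wpM2r// sum_half_le2.
apply: ler_sum => i _; rewrite /shift_coef.
have -> : \sum_(j < Q) (tau i * a i.+1 j) *: z i j = tau i *: \sum_(j < Q) a i.+1 j *: z i j.
  by rewrite scaler_sumr; apply: eq_bigr => j _; rewrite scalerA.
have [iQ|Qi] := ltnP i.+1 Q; last first.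
  rewrite big1 ?scaler0 ?normr0 ?mulr_ge0 ?exprn_ge0 ?invr_ge0// => j _.
  by rewrite sa ?Qi// scale0r.
have t0 : 0 <= tau i by rewrite tauE divr_ge0 ?exprn_ge0 ?invr_ge0// ltW.
rewrite normrZ ger0_norm//; apply: (le_trans (ler_wpM2l t0 (hK i Q a iQ))).
by rewrite tauE mulrA divfK// gt_eqF.
Qed.

End shift.

Theorem theorem5p1 (R : realType) (X : completeNormedModType R)
    (hX : exists x : nat -> X,
      [/\ normalized x, weakly_null x, basic_seq x &
        exists (Y : completeNormedModType R) (xt : nat -> Y),
          [/\ has_spreading_model x xt, ~ equiv_l1_basis xt &
              Krivine_set xt 1%E]]) :
  exists (W : set X) (T : X -> X),
    [/\ closed_subspace W, continuous_operator_on W T &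
      forall p : {poly R}, (1 < size p)%N ->
        forall lambda : R,
          ~ compact_operator_on W (fun x => poly_operator p T x - lambda *: x)].
Proof.
case: hX => x [nx wx _ [Y [xt [hsm nl1 hK]]]].
have [z [z4 coord dom]] := dominating_tower hsm wx nx nl1 hK.
have /choice[K hKK] i : exists K : R, 0 < K /\ forall Q (a : nat -> nat -> R), (i.+1 < Q)%N ->
    `|\sum_(j < Q) a i.+1 j *: z i j| <= K * `|comb z Q a|.
  by have [K K0 h] := dom i; exists K.
have K0 i : 0 < K i by have [] := hKK i.
pose tau i := 2^-1 ^+ i / K i.
have tau0 i : 0 < tau i by rewrite divr_gt0// exprn_gt0// invr_gt0.
have G0 : shift_graph z tau 0 0.
  exists 0%N, (fun _ _ => 0); split=> //; by rewrite /comb big_ord0.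
have Gbd := shift_graph_bounded K0 (fun i Q a => (hKK i).2 Q a) (fun i => erefl (tau i)).
set W := closure [set w | exists v, shift_graph z tau w v].
have GW w v : shift_graph z tau w v -> W v.
  move=> [Q [a [sa _ ->]]]; apply: subset_closure.
  exists (comb z Q (shift_coef tau (shift_coef tau a))).
  by exists Q, (shift_coef tau a); split=> //; exact: supported_shift.
have [T [clW [TW Tlin Tcont] TG]] := bounded_graph_operator G0
  (@shift_graph_linear _ _ z tau) Gbd GW.
exists W, T; split=> // p sp lambda [[_ Slin _] Scomp].
have Wz i j : W (z i j).
  apply: subset_closure; exists (comb z (i + j).+1 (shift_coef tau (unit_coef i j 1))).
  exists (i + j).+1, (unit_coef i j 1); split=> //; last first.
    by rewrite comb_unit ?scale1r// ltnS ?leq_addr ?leq_addl.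
  by apply: unit_supported; rewrite ltnS ?leq_addr ?leq_addl.
have W0 : W 0 by case: clW.
have T0 : T 0 = 0 by exact: TG.
have TZ (c : R) w : W w -> T (c *: w) = c *: T w.
  by move=> Ww; rewrite -[c *: w]addr0 Tlin// T0 addr0.
pose d := (size p).-1.
have d0 : (0 < d)%N by rewrite /d -ltnS prednK// ltnW.
pose t i := \prod_(k < i) tau (d - k.+1)%N.
have t0 i : 0 < t i by apply: prodr_gt0.
have WZ (c : R) w : W w -> W (c *: w).
  by move=> Ww; rewrite -[c *: w]addr0; case: clW => _ + _; apply.
have iterT i j : (i <= d)%N -> iter i T (z d j) = t i *: z (d - i)%N j.
  elim: i => [|i IH] id; first by rewrite /t big_ord0 scale1r subn0.
  rewrite iterS IH ?(ltnW id)// TZ// -(subnSK id) (TG _ _ (shift_graph_basis z tau _ j)).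
  by rewrite scalerA /t big_ord_recr/=.
pose S w := poly_operator p T w - lambda *: w.
(* Coefficient of [z i j] in [S (z d j)]; only at [i = d > 0] does [lambda] enter. *)
pose cf i : R := p`_(d - i) * t (d - i)%N - (if i == d then lambda else 0).
have Sz j : S (z d j) = \sum_(i < d.+1) cf i *: z i j.
  have -> : \sum_(i < d.+1) cf i *: z i j =
      \sum_(i < d.+1) (p`_(d - i) * t (d - i)%N) *: z i j - lambda *: z d j.
    rewrite 2!big_ord_recr /= -addrA; congr (_ + _).
      by apply: eq_bigr => i _; rewrite /cf ltn_eqF// subr0.
    by rewrite /cf eqxx scalerBl.
  rewrite /S /poly_operator -[size p]prednK ?(ltnW sp)// -/d; congr (_ - _).
  rewrite (reindex_inj rev_ord_inj)/=; apply: eq_bigr => i _.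
  rewrite subSS iterT ?leq_subr// subKn ?scalerA//.
  by rewrite -ltnS.
have S0 : S 0 = 0.
  have := Slin 1 0 0 W0 W0; rewrite !scale1r addr0 -/(S 0) => /eqP.
  by rewrite -subr_eq0 opprD addrA subrr sub0r oppr_eq0 => /eqP.
have SZ (c : R) w : W w -> S (c *: w) = c *: S w.
  by move=> Ww; rewrite -[c *: w]addr0 [LHS](Slin c w 0 Ww W0) -/(S 0) S0 addr0.
pose e := `|cf 0%N| / 64.
have cf0 : 0 < `|cf 0%N|.
  rewrite normr_gt0 /cf subn0 ltn_eqF// subr0; apply: mulf_neq0; last by rewrite gt_eqF.
  by rewrite -[p`_d]/(lead_coef p) lead_coef_eq0 -size_poly_gt0 ltnW.
have [||j [l [jl]]] := precompact_not_separated (u := fun j => S (4^-1 *: z d j)) (e := e) Scomp.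
- by rewrite /e divr_gt0.
- move=> j; exists (4^-1 *: z d j) => //; split=> /=; first exact: WZ.
  by rewrite normrZ gtr0_norm ?invr_gt0// ler_pdivrMl// mulr1.
rewrite !SZ// -scalerBr normrZ gtr0_norm ?invr_gt0//.
apply/negP; rewrite -leNgt /e.
suff : `|cf 0%N| <= 16 * `|S (z d j) - S (z d l)| by lra.
pose Q := (d + j + l).+1.
pose a i k : R := if (i < d.+1)%N then cf i * ((k == j)%:R - (k == l)%:R) else 0.
have inner i : \sum_(k < Q) a i k *: z i k =
    if (i < d.+1)%N then cf i *: (z i j - z i l) else 0.
  rewrite /a; case: ifP => _; last by rewrite big1// => k _; rewrite scale0r.
  have pick q : (q < Q)%N -> \sum_(k < Q) ((k == q :> nat)%:R : R) *: z i k = z i q.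
    move=> qQ; rewrite (bigD1 (Ordinal qQ))//= eqxx scale1r big1 ?addr0// => k.
    by rewrite -val_eqE/= => /negbTE->; rewrite scale0r.
  have -> : cf i *: (z i j - z i l) = cf i *: (\sum_(k < Q) (k == j :> nat)%:R *: z i k -
      \sum_(k < Q) (k == l :> nat)%:R *: z i k).
    by rewrite !pick// /Q; lia.
  rewrite -sumrB scaler_sumr; apply: eq_bigr => k _.
  by rewrite -scalerBl scalerA.
have -> : S (z d j) - S (z d l) = comb z Q a.
  rewrite !Sz -sumrB /comb (eq_bigr _ (fun (i : 'I_Q) _ => inner i)) -big_mkcond/=.
  rewrite -(big_ord_widen Q (fun i => cf i *: (z i j - z i l))); last by rewrite /Q; lia.
  by apply: eq_bigr => i _; rewrite scalerBr.
have := coord Q a 0%N j; rewrite /a eqxx (negbTE jl) subr0 mulr1; apply=> //.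
by rewrite /Q; lia.
Qed.
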